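(* Under the isomorphism $\overline{T^*(\mathrm{SL}_3/U)}\cong\overline{\mathcal{O}}_{\min}\subset\mathfrak{so}_8$ induced by $F$ (see context), which identifies the smooth locus $\overline{T^*(\mathrm{SL}_3/U)}_{\mathrm{sm}}$ with $\mathcal{O}_{\min}$, the symplectic form on $\overline{T^*(\mathrm{SL}_3/U)}_{\mathrm{sm}}$ coincides, up to a (nonzero) scalar multiple, with the Kirillov–Kostant–Souriau form $\omega^{\mathrm{KKS}}$ on the minimal nilpotent orbit $\mathcal{O}_{\min}\subset\mathfrak{so}_8$.
   Context: All varieties are over $\mathbb{C}$. Affine closure. $U\subset\mathrm{SL}_3(\mathbb{C})$ is the group of upper triangular unipotent matrices, $\overline{T^*(\mathrm{SL}_3/U)}:=\operatorname{Spec}\mathbb{C}[T^*(\mathrm{SL}_3/U)]$. The symplectic form on its smooth locus is the holomorphic $2$-form extending the canonical symplectic form of the cotangent bundle $T^*(\mathrm{SL}_3/U)$, which is an open subset of the smooth locus with complement of codimension at least $2$ in it. Quiver description. Let $V=\operatorname{Hom}(\mathbb{C},\mathbb{C}^2)\oplus\operatorname{Hom}(\mathbb{C}^2,\mathbb{C}^3)$ and let $T^*V$ be the space of tuples $(\alpha_1,\alpha_2,\beta_1,\beta_2)$, $\alpha_k\in\operatorname{Hom}(\mathbb{C}^k,\mathbb{C}^{k+1})$, $\beta_k\in\operatorname{Hom}(\mathbb{C}^{k+1},\mathbb{C}^k)$ (via the trace pairing). $\mathrm{SL}_2$ acts by $g\cdot(\alpha_1,\alpha_2,\beta_1,\beta_2)=(g\alpha_1,\alpha_2g^{-1},\beta_1g^{-1},g\beta_2)$.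 Let $N\subset T^*V$ be the zero fiber of its moment map, i.e. $(\alpha,\beta)$ with $\beta_2\alpha_2-\alpha_1\beta_1$ scalar, and $N/\!\!/\mathrm{SL}_2=\operatorname{Spec}\mathbb{C}[N]^{\mathrm{SL}_2}$. By Dancer–Kirwan–Swann $\overline{T^*(\mathrm{SL}_3/U)}\cong N/\!\!/\mathrm{SL}_2$, with $T^*(\mathrm{SL}_3/U)$ the image of $N_{\mathrm{inj}}=\{(\alpha,\beta)\in N:\alpha_1,\alpha_2\text{ injective}\}$, and its canonical symplectic form is the one obtained by Hamiltonian reduction of $N_{\mathrm{inj}}$ by $\mathrm{SL}_2$. (Here $\mathrm{SL}_3/U$ is the quotient by $\mathrm{SL}_2$ of the set of $\alpha\in V$ with injective components, $gU$ corresponding to the class of $(\iota_1,g\iota_2)$ with $\iota_k:\mathbb{C}^k\to\mathbb{C}^{k+1}$ the standard inclusions.) Isomorphism. Equip $\mathbb{C}^8$ (standard basis $e_1,\dots,e_8$) with the symmetric bilinear form $(e_i,e_j)=\delta_{i,9-j}$ and identify $\bigwedge^2\mathbb{C}^8=\mathfrak{so}_8$ by letting $v_1\wedge v_2$ act as $u\mapsto(v_1,u)v_2-(v_2,u)v_1$. Define $F:T^*V\to\operatorname{Hom}(\mathbb{C}^2,\mathbb{C}^4\oplus(\mathbb{C}^4)^* )$, with $\mathbb{C}^4=\mathbb{C}^3\oplus\mathbb{C}$, by $$F(\alpha,\beta)(v)=(\alpha_2\oplus-\beta_1)(v)\oplus\frac{(\beta_2\oplus\alpha_1)\wedge v}{e_1\wedge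 e_2},$$ where the second component is the functional $x\mapsto((\beta_2\oplus\alpha_1)(x)\wedge v)/(e_1\wedge e_2)$ on $\mathbb{C}^4$; identify $\mathbb{C}^4\oplus(\mathbb{C}^4)^*=\mathbb{C}^3\oplus\mathbb{C}\oplus\mathbb{C}^*\oplus(\mathbb{C}^3)^*$ (with $\mathbb{C}^*$ the dual of $\mathbb{C}$) with $\mathbb{C}^8$ by $\eta(z_1,z_2,z_3,a,b,w_1,w_2,w_3)=z_1e_2+z_2e_3-z_3e_8+ae_4+be_5-w_3e_1+w_2e_6+w_1e_7$. Then $(\alpha,\beta)\mapsto F(\alpha,\beta)(e_1)\wedge F(\alpha,\beta)(e_2)$ induces an isomorphism of affine varieties $N/\!\!/\mathrm{SL}_2\to\overline{\mathcal{O}}_{\min}$. Orbit and KKS form. $\mathcal{O}_{\min}\subset\mathfrak{so}_8$ is the nonzero nilpotent adjoint orbit of minimal dimension and $\overline{\mathcal{O}}_{\min}=\mathcal{O}_{\min}\cup\{0\}$. For an adjoint orbit and $\xi_Y$ the tangent vector at $X$ of the infinitesimal adjoint action of $Y$, $\omega^{\mathrm{KKS}}_X(\xi_Y,\xi_Z)=\kappa(X,[Y,Z])$, where $\kappa$ is a fixed nondegenerate invariant form (Killing form, or equivalently up to scalar the trace form). *)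

(* Defs.v *)
From mathcomp Require Import all_boot all_order all_algebra complex.
From mathcomp Require Import all_classical all_reals all_analysis.
(* The notations of [mpoly] clash with those of the analysis library. *)
From mathcomp Require Import -(notations) mpoly.

Set Implicit Arguments.
Unset Strict Implicit.
Unset Printing Implicit Defensive.

Import Order.TTheory GRing.Theory Num.Theory.
Import numFieldNormedType.Exports.

Local Open Scope classical_set_scope.
Local Open Scope ring_scope.

(** * Affine varieties and polynomial maps *)

Section Affine.
Variable K : fieldType.

Definition evalp n (p : mpoly n K) (x : 'rV[K]_n) : K :=
  meval (fun i => x ord0 i) p.

Definition diffp n (p : mpoly n K) (x u : 'rV[K]_n) : K :=
  \sum_(i < n) evalp (mderiv i p) x * u ord0 i.

Definition evalmap m n (f : 'I_n -> mpoly m K) (x : 'rV[K]_m) : 'rV[K]_n :=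
  \row_i evalp (f i) x.

Definition diffmap m n (f : 'I_n -> mpoly m K) (x u : 'rV[K]_m) : 'rV[K]_n :=
  \row_i diffp (f i) x u.

Definition vanishing n (S : set 'rV[K]_n) : set (mpoly n K) :=
  [set p | forall x, S x -> evalp p x = 0].

Definition zariski_closure n (S : set 'rV[K]_n) : set 'rV[K]_n :=
  [set x | forall p, vanishing S p -> evalp p x = 0].

Definition tangent n (S : set 'rV[K]_n) (x : 'rV[K]_n) : set 'rV[K]_n :=
  [set u | forall p, vanishing S p -> diffp p x u = 0].

(* There are [d] algebraically independent functions in the coordinate ring
   of [S]. *)
Definition has_alg_indep n (S : set 'rV[K]_n) (d : nat) : Prop :=
  exists f : 'I_d -> mpoly n K, forall P : mpoly d K,
    (forall x, S x -> evalp P (evalmap f x) = 0) -> P = 0.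

(* Dimension as the transcendence degree of the coordinate ring; it never
   exceeds the dimension [n] of the ambient space. *)
Definition vdim n (S : set 'rV[K]_n) : nat :=
  \max_(d < n.+1 | `[< has_alg_indep S d >]) d.

(* Smooth points of an irreducible closed subvariety: the Zariski tangent space
   has the dimension of the variety. *)
Definition smooth_locus n (X : set 'rV[K]_n) : set 'rV[K]_n :=
  [set x | X x /\ exists B : 'M[K]_(vdim X, n),
     row_free B /\ forall u, tangent X x u <-> (u <= B)%MS].

Definition is_isomorphism m n (X : set 'rV[K]_m) (Y : set 'rV[K]_n)
    (f : 'I_n -> mpoly m K) : Prop :=
  exists g : 'I_m -> mpoly n K,
    [/\ forall x, X x -> Y (evalmap f x),
        forall y, Y y -> X (evalmap g y),
        forall x, X x -> evalmap g (evalmap f x) = x &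
        forall y, Y y -> evalmap f (evalmap g y) = y].

End Affine.

(** * The quiver description *)

Section Quiver.
Variable K : fieldType.

Record cotangentV := CotangentV {
  alpha1 : 'M[K]_(2, 1);
  alpha2 : 'M[K]_(3, 2);
  beta1 : 'M[K]_(1, 2);
  beta2 : 'M[K]_(2, 3) }.

Definition dimTV : nat := (2 * 1 + (3 * 2 + (1 * 2 + 2 * 3)))%N.

Definition coords (q : cotangentV) : 'rV[K]_dimTV :=
  row_mx (mxvec (alpha1 q)) (row_mx (mxvec (alpha2 q))
    (row_mx (mxvec (beta1 q)) (mxvec (beta2 q)))).

Definition act (g : 'M[K]_2) (q : cotangentV) : cotangentV :=
  CotangentV (g *m alpha1 q) (alpha2 q *m invmx g)
             (beta1 q *m invmx g) (g *m beta2 q).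

Definition N : set cotangentV :=
  [set q | is_scalar_mx (beta2 q *m alpha2 q - alpha1 q *m beta1 q)].

Definition Ninj : set cotangentV :=
  [set q | [/\ N q, injective (fun v : 'cV[K]_1 => alpha1 q *m v) &
               injective (fun v : 'cV[K]_2 => alpha2 q *m v)]].

(* Kernel of the differential of the moment map at [q]; this is the tangent
   space of [N] at the points of [Ninj], where SL_2 acts freely. *)
Definition tangentN (q : cotangentV) : set cotangentV :=
  [set u | is_scalar_mx (beta2 u *m alpha2 q + beta2 q *m alpha2 u
                         - (alpha1 u *m beta1 q + alpha1 q *m beta1 u))].

(* Exterior derivative of the tautological 1-form
   \tr (beta1 *m d alpha1) + \tr (beta2 *m d alpha2). *)
Definition omegaV (u v : cotangentV) : K :=
  (\tr (beta1 u *m alpha1 v) + \tr (beta2 u *m alpha2 v))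
  - (\tr (beta1 v *m alpha1 u) + \tr (beta2 v *m alpha2 u)).

Definition invariant_on_N (p : mpoly dimTV K) : Prop :=
  forall (g : 'M[K]_2) (q : cotangentV), \det g = 1 -> N q ->
    evalp p (coords (act g q)) = evalp p (coords q).

(* The components of [f] restrict to generators of the algebra C[N]^{SL_2}. *)
Definition generates_invariants n (f : 'I_n -> mpoly dimTV K) : Prop :=
  (forall i, invariant_on_N (f i)) /\
  (forall p, invariant_on_N p -> exists h : mpoly n K,
     forall q, N q -> evalp p (coords q) = evalp h (evalmap f (coords q))).

(* When [f] generates the invariants, the kernel of C[x_1..x_n] -> C[N]^{SL_2}
   consists of the polynomials vanishing on the image of [N], so this is
   N // SL_2 = Spec C[N]^{SL_2} as a closed subvariety of affine n-space. *)
Definition quotientN n (f : 'I_n -> mpoly dimTV K) : set 'rV[K]_n :=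
  zariski_closure [set evalmap f (coords q) | q in N].

End Quiver.

(** * The Lie algebra so_8 *)

Section SO8.
Variable K : fieldType.

Definition J8 : 'M[K]_8 := \matrix_(i, j) (i + j == 7)%N%:R.

Definition so8 : set 'M[K]_8 := [set A | A^T *m J8 + J8 *m A = 0].

Definition SO8 : set 'M[K]_8 := [set g | g^T *m J8 *m g = J8 /\ \det g = 1].

Definition lie (A B : 'M[K]_8) : 'M[K]_8 := A *m B - B *m A.

Definition orbit8 (X : 'M[K]_8) : set 'M[K]_8 :=
  [set g *m X *m invmx g | g in SO8].

Definition nonzero_nilpotent (X : 'M[K]_8) : Prop :=
  [/\ so8 X, X != 0 & exists k : nat, X ^+ k = 0].

Definition dim8 (S : set 'M[K]_8) : nat := vdim (mxvec @` S).

Definition is_minimal_nilpotent_orbit (Omin : set 'M[K]_8) : Prop :=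
  exists2 X, nonzero_nilpotent X /\ Omin = orbit8 X &
    forall Y, nonzero_nilpotent Y -> (dim8 Omin <= dim8 (orbit8 Y))%N.

Definition wedge8 (v1 v2 : 'cV[K]_8) : 'M[K]_8 :=
  v2 *m (v1^T *m J8) - v1 *m (v2^T *m J8).

(* The invariant form: the trace form, a nonzero multiple of the Killing
   form. *)
Definition kappa (A B : 'M[K]_8) : K := \tr (A *m B).

(* The Kirillov-Kostant-Souriau form at [X] on vectors xi_Y = [Y, X] and
   xi_Z = [Z, X] tangent to the orbit of [X]; the value is independent of the
   choice of [Y] and [Z]. (It is 0, by convention, on vectors that are not
   tangent to the orbit.) *)
Definition KKS (X a b : 'M[K]_8) : K :=
  xget 0 [set r | exists Y Z, [/\ so8 Y, so8 Z, a = lie Y X, b = lie Z X &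
                                  r = kappa X (lie Y Z)]].

(** * The map F *)

(* u /\ v divided by e_1 /\ e_2 *)
Definition wedge2 (u v : 'cV[K]_2) : K := \det (row_mx u v : 'M[K]_2).

(* The components of [F q v] in C^3, C, C^*, (C^3)^*, the last two in the
   dual bases. *)
Definition Fz (q : cotangentV K) (v : 'cV[K]_2) : 'cV[K]_3 := alpha2 q *m v.
Definition Fa (q : cotangentV K) (v : 'cV[K]_2) : K :=
  (- beta1 q *m v) ord0 ord0.
Definition Fb (q : cotangentV K) (v : 'cV[K]_2) : K := wedge2 (alpha1 q) v.
Definition Fw (q : cotangentV K) (v : 'cV[K]_2) : 'cV[K]_3 :=
  \col_k wedge2 (col k (beta2 q)) v.

Definition eta8 (z : 'cV[K]_3) (a b : K) (w : 'cV[K]_3) : 'cV[K]_8 :=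
  let e (k : nat) : 'cV[K]_8 := delta_mx (inord k.-1) ord0 in
  let c (x : 'cV[K]_3) (k : nat) : K := x (inord k.-1) ord0 in
  c z 1%N *: e 2%N + c z 2%N *: e 3%N - c z 3%N *: e 8%N
  + a *: e 4%N + b *: e 5%N
  - c w 3%N *: e 1%N + c w 2%N *: e 6%N + c w 1%N *: e 7%N.

Definition F8 (q : cotangentV K) (v : 'cV[K]_2) : 'cV[K]_8 :=
  eta8 (Fz q v) (Fa q v) (Fb q v) (Fw q v).

Definition Psi (q : cotangentV K) : 'M[K]_8 :=
  wedge8 (F8 q (delta_mx ord0 ord0)) (F8 q (delta_mx ord_max ord0)).

End SO8.

(** * Holomorphic 2-forms *)

(* The complex numbers, packaged so that the topology and the norm of
   [numFieldNormedType] apply to [R[i]] itself; [differentiable] below is thus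
   complex differentiability. *)
Definition Cplx (R : realType) : numClosedFieldType := R[i].

Section Forms.
Variable R : realType.
Local Notation C := (Cplx R).

Definition form2 n := 'rV[C]_n -> 'rV[C]_n -> 'rV[C]_n -> C.

(* [omega x] is an alternating bilinear form on the tangent space at each
   smooth point [x] of [X]; near each smooth point its coefficients extend to
   holomorphic functions on an open subset of the ambient affine space. *)
Definition holomorphic_form2 n (X : set 'rV[C]_n) (omega : form2 n) : Prop :=
  forall x, smooth_locus X x ->
    (forall u, tangent X x u -> omega x u u = 0) /\
    exists A : 'rV[C]_n -> 'M[C]_n, \forall y \near x,
      differentiable A y /\
      (smooth_locus X y -> forall u v, tangent X y u -> tangent X y v ->
         omega y u v = (u *m A y *m v^T) ord0 ord0).

(* The symplectic form on the smooth locus of N // SL_2, the affine closure of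
   T^*(SL_3/U) = Ninj / SL_2. On the latter the canonical form is obtained by
   Hamiltonian reduction: its pullback to Ninj is the restriction of
   [omegaV]. *)
Definition is_symplectic_form n (f : 'I_n -> mpoly dimTV C) (omega : form2 n) :
    Prop :=
  holomorphic_form2 (quotientN f) omega /\
  forall q, Ninj q -> forall u v, tangentN q u -> tangentN q v ->
    omega (evalmap f (coords q)) (diffmap f (coords q) (coords u))
                                 (diffmap f (coords q) (coords v))
    = omegaV u v.

End Forms.

(* Main.v *)
Require Import Defs.
From mathcomp Require Import all_boot all_order all_algebra complex.
From mathcomp Require Import all_classical all_reals all_analysis.
From mathcomp Require Import -(notations) mpoly.
From mathcomp Require Import zify ring.

Set Implicit Arguments.
Unset Strict Implicit.
Unset Printing Implicit Defensive.

Import Order.TTheory GRing.Theory Num.Theory.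
Import numFieldNormedType.Exports.

Local Open Scope classical_set_scope.
Local Open Scope ring_scope.

(* The map [F] identifies [T^*V] with pairs [G = (v_1, v_2)] of vectors of C^8,
   and [N] with the pairs that span an isotropic subspace. Hence the closure of
   [Omin] is the set of all [v_1 /\ v_2] with [v_1], [v_2] isotropic and
   orthogonal, and the orbit [Omin] consists of the nonzero ones. Infinitesimally,
   a vector [U] tangent to [N] at an independent pair [G] is [A G] with [A] in
   so_8, so that its image in the tangent space of [Omin] at [x = v_1 /\ v_2] is
   [[A, x]]; the tangent space of [Omin] is no larger because of the Pluecker
   relations and of [x ^+ 2 = 0]. In these terms both forms are explicit: for
   [U = A G], [V = B G] one finds [omegaV = (u_2, v_1) - (u_1, v_2)] (columns of
   [U] and [V]) and [\tr (x [A, B]) = 2 omegaV], whence the factor 1/2 on the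
   image of [Ninj]. Since both forms are so_8-invariant and every point can be
   moved into this image by elements [1 + s y] of SO_8, with [y] in the closure
   of [Omin] and [s] arbitrarily small, continuity gives the equality on the
   whole smooth locus. That the smooth locus is exactly [Omin] follows by
   computing the dimension 10 from an affine chart, homogeneity, and the size of
   the tangent space at the vertex. *)

(** * Polynomial maps *)

Section PolynomialMaps.
Variable K : fieldType.

(** Constants and variables generate the polynomial ring, so compatibility of evaluation and
    differentiation with substitution can be checked on them. *)
Lemma mpoly_ring_ind n (P : mpoly n K -> Prop) :
  (forall c, P (mpolyC n c)) -> (forall i, P (mpolyX K (mnm1 i))) ->
  (forall p q, P p -> P q -> P (p + q)) ->
  (forall p q, P p -> P q -> P (p * q)) -> forall p, P p.
Proof.
move=> PC PX PD PM p; rewrite (mpolyE p).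
have P0 : P 0 by rewrite -mpolyC0.
have P1 : P 1 by rewrite -mpolyC1.
apply: (big_ind P) => // m _; rewrite -mul_mpolyC; apply: (PM) => //.
rewrite mpolyXE_id; apply: (big_ind P) => // i _.
by elim: (X in _ ^+ X) => [|k IH]; rewrite ?expr0 ?exprS //; apply: PM.
Qed.

(** Substituting a polynomial curve for the variables reduces questions about [p] along the curve to
    one univariate polynomial. *)
Definition evalp_curve n (p : mpoly n K) (g : 'I_n -> {poly K}) : {poly K} :=
  mmap polyC g p.

Lemma evalp_curve_horner n (p : mpoly n K) g s :
  (evalp_curve p g).[s] = evalp p (\row_i (g i).[s]).
Proof.
rewrite /evalp_curve /evalp.
elim/mpoly_ring_ind: p => [c|i|p q Hp Hq|p q Hp Hq].
- by rewrite mmapC mevalC hornerC.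
- by rewrite mmapX mmap1U mevalXU mxE.
- by rewrite mmapD mevalD hornerD Hp Hq.
- by rewrite !rmorphM /= hornerM Hp Hq.
Qed.

Lemma evalpD n (p q : mpoly n K) x : evalp (p + q) x = evalp p x + evalp q x.
Proof. exact: mevalD. Qed.
Lemma evalpB n (p q : mpoly n K) x : evalp (p - q) x = evalp p x - evalp q x.
Proof. exact: mevalB. Qed.
Lemma evalpM n (p q : mpoly n K) x : evalp (p * q) x = evalp p x * evalp q x.
Proof. exact: mevalM. Qed.
Lemma evalpC n c (x : 'rV[K]_n) : evalp (mpolyC n c) x = c.
Proof. exact: mevalC. Qed.
Lemma evalpX n i (x : 'rV[K]_n) : evalp (mpolyX K (mnm1 i)) x = x ord0 i.
Proof. exact: mevalXU. Qed.

Lemma diffpC n c (x u : 'rV[K]_n) : diffp (mpolyC n c) x u = 0.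
Proof.
by rewrite /diffp big1 // => i _; rewrite mderivC /evalp meval0 mul0r.
Qed.

Lemma diffpX n i (x u : 'rV[K]_n) : diffp (mpolyX K (mnm1 i)) x u = u ord0 i.
Proof.
rewrite /diffp (bigD1 i) //= big1 => [|j ij].
  rewrite mderivX mnm1E eqxx scale1r.
  have -> : mnm_sub (mnm1 i) (mnm1 i) = mnm0.
    by apply/mnmP => k; rewrite mnmBE subnn mnm0E.
  by rewrite mpolyX0 /evalp meval1 mul1r addr0.
by rewrite mderivX mnm1E eq_sym (negPf ij) scale0r /evalp meval0 mul0r.
Qed.

Lemma diffpD n (p q : mpoly n K) x u :
  diffp (p + q) x u = diffp p x u + diffp q x u.
Proof.
rewrite /diffp -big_split; apply: eq_bigr => i _ /=.
by rewrite mderivD evalpD mulrDl.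
Qed.

Lemma diffpM n (p q : mpoly n K) x u :
  diffp (p * q) x u = diffp p x u * evalp q x + evalp p x * diffp q x u.
Proof.
rewrite /diffp mulr_suml mulr_sumr -big_split; apply: eq_bigr => i _ /=.
by rewrite mderivM evalpD !evalpM mulrDl mulrAC !mulrA.
Qed.

Lemma diffpB n (p q : mpoly n K) x u :
  diffp (p - q) x u = diffp p x u - diffp q x u.
Proof.
have <- : diffp (- q) x u = - diffp q x u.
  by rewrite -mulN1r -mpolyC1 -mpolyCN diffpM diffpC evalpC mul0r add0r mulN1r.
exact: diffpD.
Qed.

Lemma diffp_linear n (p : mpoly n K) x a u v :
  diffp p x (a *: u + v) = a * diffp p x u + diffp p x v.
Proof.
rewrite /diffp mulr_sumr -big_split; apply: eq_bigr => i _ /=.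
by rewrite !mxE mulrDr mulrCA.
Qed.

Definition comp_map m n (p : mpoly n K) (f : 'I_n -> mpoly m K) : mpoly m K :=
  mmap (@mpolyC m K) f p.

Lemma evalp_comp m n (p : mpoly n K) (f : 'I_n -> mpoly m K) x :
  evalp (comp_map p f) x = evalp p (evalmap f x).
Proof.
rewrite /comp_map; elim/mpoly_ring_ind: p => [c|i|p q Hp Hq|p q Hp Hq].
- by rewrite mmapC !evalpC.
- by rewrite mmapX mmap1U evalpX mxE.
- by rewrite mmapD !evalpD Hp Hq.
- by rewrite rmorphM /= !evalpM Hp Hq.
Qed.

Lemma diffp_comp m n (p : mpoly n K) (f : 'I_n -> mpoly m K) x u :
  diffp (comp_map p f) x u = diffp p (evalmap f x) (diffmap f x u).
Proof.
have E q := evalp_comp q f x; rewrite /comp_map in E *.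
elim/mpoly_ring_ind: p => [c|i|p q Hp Hq|p q Hp Hq].
- by rewrite mmapC !diffpC.
- by rewrite mmapX mmap1U diffpX mxE.
- by rewrite mmapD !diffpD Hp Hq.
- by rewrite rmorphM /= !diffpM Hp Hq !E.
Qed.

Lemma diffmap_linear m n (f : 'I_n -> mpoly m K) x a u v :
  diffmap f x (a *: u + v) = a *: diffmap f x u + diffmap f x v.
Proof. by apply/rowP => i; rewrite !mxE diffp_linear. Qed.

Definition jacobian_mx m n (f : 'I_n -> mpoly m K) (x : 'rV[K]_m) : 'M[K]_(m, n) :=
  \matrix_(i, j) evalp (mderiv i (f j)) x.

Lemma diffmapE m n (f : 'I_n -> mpoly m K) x u :
  diffmap f x u = u *m jacobian_mx f x.
Proof.
apply/rowP => i; rewrite !mxE; apply: eq_bigr => j _.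
by rewrite !mxE mulrC.
Qed.

Lemma diffp_curve n (p : mpoly n K) (x : 'rV[K]_n) (g : 'I_n -> {poly K}) :
  (forall i, (g i)`_0 = x ord0 i) ->
  (evalp_curve p g)`_1 = diffp p x (\row_i (g i)`_1).
Proof.
move=> g0; have E q : (evalp_curve q g)`_0 = evalp q x.
  rewrite -horner_coef0 evalp_curve_horner; congr evalp.
  by apply/rowP => i; rewrite mxE horner_coef0.
rewrite /evalp_curve in E *; elim/mpoly_ring_ind: p => [c|i|p q Hp Hq|p q Hp Hq].
- by rewrite mmapC coefC diffpC.
- by rewrite mmapX mmap1U diffpX mxE.
- by rewrite mmapD coefD diffpD Hp Hq.
- rewrite rmorphM /= coefM diffpM 2!big_ord_recl big_ord0 /= Hp Hq !E.
  by rewrite addr0 addrC.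
Qed.

End PolynomialMaps.

(** * Polynomials over a field of characteristic zero *)

Section InfiniteField.
Variable K : numFieldType.


Lemma poly_eq0_horner (p : {poly K}) : (forall s, p.[s] = 0) -> p = 0.
Proof.
move=> E; apply: (@roots_geq_poly_eq0 _ p [seq i%:R | i <- iota 0 (size p)]).
- by apply/allP => s _; rewrite rootE E.
- by rewrite map_inj_uniq ?iota_uniq // => i j /eqP; rewrite eqr_nat => /eqP.
- by rewrite size_map size_iota.
Qed.

Lemma poly_eq_horner (p q : {poly K}) : (forall s, p.[s] = q.[s]) -> p = q.
Proof.
move=> E; apply/eqP; rewrite -subr_eq0; apply/eqP/poly_eq0_horner => s.
by rewrite hornerD hornerN E subrr.
Qed.

(** The product [D * p] vanishes everywhere. This is the algebraic form of passing to a limit: what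
    holds off the roots of [D] also holds at them. *)
Lemma poly_eq0_off_roots (D p : {poly K}) :
  D != 0 -> (forall s, D.[s] != 0 -> p.[s] = 0) -> p = 0.
Proof.
move=> D0 E; apply/eqP.
have /eqP : D * p = 0.
  apply: poly_eq0_horner => s; rewrite hornerM.
  by have [->|/E->] := eqVneq D.[s] 0; rewrite ?mul0r ?mulr0.
by rewrite mulf_eq0 (negPf D0).
Qed.

(** The field is infinite, so the values on the line determine [P]; derivatives can then be read off
    from values on lines. *)
Lemma diffp_line n (p : mpoly n K) (x u : 'rV[K]_n) (P : {poly K}) :
  (forall s, evalp p (x + s *: u) = P.[s]) -> diffp p x u = P`_1.
Proof.
move=> E; pose g i : {poly K} := (x ord0 i)%:P + u ord0 i *: 'X.
have -> : P = evalp_curve p g.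
  apply: poly_eq_horner => s; rewrite -E evalp_curve_horner; congr evalp.
  by apply/rowP => i; rewrite !mxE !hornerE mulrC.
rewrite (@diffp_curve K n p x) => [|i]; last by rewrite coefD coefC coefZ coefX mulr0 addr0.
congr diffp; apply/rowP => i; rewrite mxE.
by rewrite coefD coefC coefZ coefX mulr1 add0r.
Qed.

(** Induction on the degree of the monomial: the partial derivatives of [p] vanish everywhere too,
    and in characteristic zero the coefficient of [m] is recovered from that of [m'] in a
    derivative. *)
Lemma mpoly_eq0_evalp n (p : mpoly n K) : (forall x, evalp p x = 0) -> p = 0.
Proof.
move=> p0; apply/mpolyP => m; rewrite mcoeff0.
have [k] := ubnP (mdeg m); elim: k m p p0 => // k IH m p p0 mk.
have [/eqP|m0] := eqVneq (mdeg m) 0%N.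
  rewrite mdeg_eq0 => /eqP ->; rewrite -[RHS](p0 0) /evalp.
  elim/mpoly_ring_ind: (p) => [c|i|q r Hq Hr|q r Hq Hr].
  - by rewrite mcoeffC eqxx mulr1 mevalC.
  - by rewrite mcoeffX mevalXU mxE -mdeg_eq0 mdeg1.
  - by rewrite mcoeffD mevalD Hq Hr.
  - by rewrite rmorphM /= mevalM Hq Hr.
have [i mi] : exists i, m i != 0%N.
  apply/existsP; apply: contraR m0; rewrite negb_exists => /forallP m0.
  rewrite mdeg_eq0; apply/eqP/mnmP => i; rewrite mnm0E.
  by have := m0 i; rewrite negbK => /eqP.
pose m' := mnm_sub m (mnm1 i).
have Em : m = mnm_add m' (mnm1 i).
  apply/mnmP => j; rewrite mnmDE mnmBE mnm1E.
  by case: eqP => [<-|_]; rewrite ?subn0 ?addn0 // subnK // lt0n.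
have : mcoeff m' (mderiv i p) = 0.
  apply: IH => [x|]; last by move: mk; rewrite Em mdegD mdeg1 addn1 ltnS.
  have <- : diffp p x (delta_mx ord0 i) = 0.
    by rewrite (@diffp_line _ p x _ 0) ?coef0 // => s; rewrite p0 horner0.
  rewrite /diffp (bigD1 i) //= big1 => [|j /negPf ji].
    by rewrite mxE !eqxx mulr1 addr0.
  by rewrite mxE ji andbF mulr0.
rewrite mcoeff_mderiv -Em => /eqP.
by rewrite mulrn_eq0 /= => /eqP.
Qed.

End InfiniteField.

(** * Algebraic dependence of more polynomials than variables *)

Section AlgebraicDependence.
Variable K : fieldType.

(** Exponents bounded by [D] are indexed by a finite type so that they can be counted. *)
Definition mnm_of_ffun n D (a : {ffun 'I_n -> 'I_D}) : multinom n :=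
  Multinom [tuple (a i : nat) | i < n].

Lemma mnm_of_ffunE n D (a : {ffun 'I_n -> 'I_D}) i : mnm_of_ffun a i = a i.
Proof. by rewrite multinomE tnth_mktuple. Qed.

Lemma mnm_of_ffun_inj n D : injective (@mnm_of_ffun n D).
Proof.
move=> a b /mnmP E; apply/ffunP => i; apply: val_inj.
by have := E i; rewrite !mnm_of_ffunE.
Qed.

Lemma msizeM_leq n (p q : mpoly n K) k l :
  (mmeasure mdeg p <= k.+1)%N -> (mmeasure mdeg q <= l.+1)%N ->
  (mmeasure mdeg (p * q) <= (k + l).+1)%N.
Proof.
have [->|p0] := eqVneq p 0; first by rewrite mul0r mmeasure0.
have [->|q0] := eqVneq q 0; first by rewrite mulr0 mmeasure0.
move=> hp hq; rewrite msizeM // (leq_trans (_ : _ <= (k.+1 + l.+1).-1)%N) //.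
  by rewrite -!subn1 leq_sub2r // leq_add.
by rewrite addnS.
Qed.

Lemma msizeX_leq n (p : mpoly n K) k j :
  (mmeasure mdeg p <= k.+1)%N -> (mmeasure mdeg (p ^+ j) <= (j * k).+1)%N.
Proof.
move=> hp; elim: j => [|j IH]; first by rewrite expr0 msize1.
by rewrite exprS mulSn; apply: msizeM_leq.
Qed.

(* There are [D ^ d] monomials in [d] variables with exponents below [D]; they
   are mapped to polynomials of degree O(D) in fewer than [d] variables. *)
Lemma alg_dependent m d (h : 'I_d -> mpoly m K) : (m < d)%N ->
  exists2 P : mpoly d K, P != 0 & comp_map P h = 0.
Proof.
move=> md; pose e := (\max_i mmeasure mdeg (h i))%N.
(* Every [F a] has size at most [E], and [E <= D * c]. Since [c ^ m < D] and [m < d], there are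
   fewer columns, [E ^ m], than rows, [D ^ d]. *)
pose c := (d * e).+1; pose D := (c ^ m).+1; pose E := (d * (D * e)).+1.
pose F (a : {ffun 'I_d -> 'I_D}) : mpoly m K := \prod_i h i ^+ a i.
have szF a : (mmeasure mdeg (F a) <= E)%N.
  rewrite /F /E -[X in (X * (D * e))%N](size_enum_ord d) -big_enum /=.
  elim: (enum 'I_d) => [|i s IH]; first by rewrite big_nil msize1.
  rewrite big_cons mulSn msizeM_leq // (leq_trans (@msizeX_leq _ _ e _ _)) //.
    by rewrite leqW // /e (bigD1 i) //= leq_maxl.
  by rewrite ltnS leq_mul2r (ltnW (ltn_ord _)) orbT.
pose A := \matrix_(r < #|{ffun 'I_d -> 'I_D}|, s < #|{ffun 'I_m -> 'I_E}|)
  mcoeff (mnm_of_ffun (enum_val s)) (F (enum_val r)).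
have ltA : (#|{ffun 'I_m -> 'I_E}| < #|{ffun 'I_d -> 'I_D}|)%N.
  rewrite !card_ffun !card_ord (@leq_ltn_trans (D ^ m * c ^ m)) //.
    have EDc : (E <= D * c)%N by rewrite /E /c mulnS mulnCA -add1n leq_add2r.
    by rewrite -expnMn; case: (m) => // m'; rewrite leq_exp2r.
  apply: (@leq_trans (D ^ m.+1)); last exact: leq_pexp2l.
  by rewrite expnSr ltn_pmul2l ?expn_gt0.
have /rowV0Pn[v /sub_kermxP vA v0] : kermx A != 0.
  by rewrite -mxrank_eq0 mxrank_ker subn_eq0 -ltnNge (leq_ltn_trans (rank_leq_col _)).
exists (\sum_r v ord0 r *: mpolyX K (mnm_of_ffun (enum_val r))).
  apply: contra_neq v0 => P0; apply/rowP => r; rewrite mxE.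
  have := congr1 (mcoeff (mnm_of_ffun (enum_val r))) P0.
  rewrite mcoeff0 raddf_sum /= (bigD1 r) //= big1 => [|r' /negPf r'r].
    by rewrite mcoeffZ mcoeffX eqxx mulr1 addr0.
  rewrite mcoeffZ mcoeffX (inj_eq (@mnm_of_ffun_inj _ _)) (inj_eq enum_val_inj).
  by rewrite r'r mulr0.
rewrite /comp_map raddf_sum /=.
under eq_bigr => r _.
  rewrite mmapZ mmapX /mmap1.
  under eq_bigr => i _ do rewrite mnm_of_ffunE.
  rewrite -/(F (enum_val r)) mul_mpolyC; over.
apply/mpolyP => b; rewrite mcoeff0 raddf_sum /=.
under eq_bigr => r _ do rewrite mcoeffZ.
(* Monomials of degree below [E] are columns of [A], where the kernel vector applies; the others
   occur in no [F a]. *)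
have [bE|bE] := ltnP (mdeg b) E.
  have bi i : (b i < E)%N.
    by rewrite (leq_ltn_trans _ bE) // mdegE (bigD1 i) //= leq_addr.
  have Eb : b = mnm_of_ffun (enum_val (enum_rank [ffun i => Ordinal (bi i)])).
    by apply/mnmP => i; rewrite mnm_of_ffunE enum_rankK ffunE.
  rewrite Eb; have /rowP/(_ (enum_rank [ffun i => Ordinal (bi i)])) := vA.
  rewrite !mxE => {2}<-; apply: eq_bigr => r _.
  by rewrite mxE.
rewrite big1 // => r _; rewrite memN_msupp_eq0 ?mulr0 // msize_mdeg_ge //.
exact: leq_trans (szF _) bE.
Qed.

End AlgebraicDependence.

(** * Isotropic planes in C^8 *)

Section IsotropicPlanes.
Variable K : fieldType.
Local Notation J := (J8 K).

Lemma sum_ord2 (V : zmodType) (F : 'I_2 -> V) :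
  \sum_i F i = F ord0 + F ord_max.
Proof.
rewrite !big_ord_recl big_ord0 addr0; congr (_ + F _).
exact: val_inj.
Qed.

Lemma ord2P (i : 'I_2) : i = ord0 \/ i = ord_max.
Proof. by case: i => -[|[|]] // h; [left|right]; apply: val_inj. Qed.

Lemma mx22P (A B : 'M[K]_2) :
  A ord0 ord0 = B ord0 ord0 -> A ord0 ord_max = B ord0 ord_max ->
  A ord_max ord0 = B ord_max ord0 -> A ord_max ord_max = B ord_max ord_max ->
  A = B.
Proof.
move=> E1 E2 E3 E4; apply/matrixP => i j.
by case: (ord2P i) (ord2P j) => -> [] ->.
Qed.

Lemma det22 (A : 'M[K]_2) :
  \det A = A ord0 ord0 * A ord_max ord_max - A ord0 ord_max * A ord_max ord0.
Proof.
rewrite (expand_det_row _ ord0) sum_ord2 /cofactor !det_mx11 !mxE /=.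
rewrite expr0 expr1 mul1r mulN1r mulrN.
by congr (_ * A _ _ - _ * A _ _); apply: val_inj.
Qed.

(** With [v_1], [v_2] the columns of [G], [G eps G^T] is the bivector [v_1 v_2^T - v_2 v_1^T].
    Locking prevents simplification from expanding it. *)
Definition eps : 'M[K]_2 :=
  locked (delta_mx ord0 ord_max - delta_mx ord_max ord0).

Lemma epsE : (eps ord0 ord0 = 0) * (eps ord0 ord_max = 1) *
  (eps ord_max ord0 = -1) * (eps ord_max ord_max = 0).
Proof. by rewrite /eps -lock !mxE /= !subr0 sub0r. Qed.

Definition minor2 (G : 'M[K]_(8, 2)) (i j : 'I_8) : K :=
  G i ord0 * G j ord_max - G i ord_max * G j ord0.

(* The matrix [G] stands for the pair of its columns [v_1], [v_2], and [plane G]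
   for [v_1 /\ v_2] in so_8. *)
Definition plane (G : 'M[K]_(8, 2)) : 'M[K]_8 := - (G *m eps *m G^T *m J).

Definition dplane (G U : 'M[K]_(8, 2)) : 'M[K]_8 :=
  - (G *m eps *m U^T *m J + U *m eps *m G^T *m J).

Definition isotropic (G : 'M[K]_(8, 2)) : Prop := G^T *m J *m G = 0.

Definition isotangent (G U : 'M[K]_(8, 2)) : Prop :=
  G^T *m J *m U + U^T *m J *m G = 0.

Lemma trJ : J^T = J.
Proof. by apply/matrixP => i j; rewrite !mxE addnC. Qed.

Lemma JJ : J *m J = 1%:M.
Proof.
apply/matrixP => i j; rewrite !mxE (bigD1 (rev_ord i)) //= big1 => [|k ki].
  rewrite !mxE addr0 (_ : _ == 7)%N ?mul1r; last by case: i => i /=; lia.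
  by congr (_%:R); case: i j => i hi [j hj]; rewrite -val_eqE /=; lia.
rewrite !mxE; case: eqP => [E|]; last by rewrite mul0r.
by case/eqP: ki; apply: val_inj => /=; case: i k E => i hi [k hk] /=; lia.
Qed.

Lemma trE : eps^T = - eps.
Proof. by apply: mx22P; rewrite !mxE !epsE ?oppr0 ?opprK. Qed.

Lemma eps_congr (a : 'M[K]_2) : a *m eps *m a^T = \det a *: eps.
Proof.
by rewrite det22; apply: mx22P; rewrite !mxE !sum_ord2 !mxE !sum_ord2 !epsE; ring.
Qed.

Lemma eps_congr_tr (a : 'M[K]_2) : a^T *m eps *m a = \det a *: eps.
Proof. by have := eps_congr a^T; rewrite trmxK det_tr. Qed.

Lemma epseps : eps *m eps = - 1%:M.
Proof.
by apply: mx22P; rewrite !mxE !sum_ord2 !epsE /=; ring.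
Qed.

Lemma det_eps : \det eps = 1.
Proof. by rewrite det22 !epsE; ring. Qed.

Lemma planeJ G i j : (plane G *m J) i j = - minor2 G i j.
Proof.
rewrite /plane mulNmx -!mulmxA JJ mulmx1 mulmxA !mxE sum_ord2 !mxE !sum_ord2 !epsE.
by rewrite /minor2; ring.
Qed.

Lemma plane_col G a : plane (G *m a) = \det a *: plane G.
Proof.
rewrite /plane trmx_mul !mulmxA -(mulmxA G) -(mulmxA G) eps_congr.
by rewrite -scalemxAr -!scalemxAl scalerN.
Qed.

Lemma isotropic_col G a : isotropic G -> isotropic (G *m a).
Proof.
rewrite /isotropic trmx_mul => G0.
by rewrite !mulmxA -(mulmxA a^T) -(mulmxA a^T) G0 mulmx0 mul0mx.
Qed.

Lemma so8P A : so8 A <-> A^T *m J = - (J *m A).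
Proof. by rewrite /so8 /=; split => [/eqP|->]; rewrite ?addNr // addr_eq0 => /eqP. Qed.

Lemma so8_plane G : so8 (plane G).
Proof.
apply/so8P; rewrite /plane linearN /= mulNmx mulmxN opprK !trmx_mul trmxK trJ trE.
by rewrite mulNmx !mulmxN mulNmx opprK !mulmxA.
Qed.

Lemma plane_self G : isotropic G -> plane G *m G = 0.
Proof. by move=> G0; rewrite /plane mulNmx -!mulmxA (mulmxA G^T) G0 !mulmx0 oppr0. Qed.

Lemma plane_sq G : isotropic G -> plane G *m plane G = 0.
Proof.
by move=> G0; rewrite {2}/plane mulmxN !mulmxA plane_self // !mul0mx oppr0.
Qed.

Lemma minor2_neq0 G : plane G != 0 -> exists i j, minor2 G i j != 0.
Proof.
move=> Gn; apply: contrapT => E; case/eqP: Gn.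
rewrite -[plane G]mulmx1 -JJ mulmxA (_ : plane G *m J = 0) ?mul0mx //.
apply/matrixP => i j; rewrite planeJ mxE.
have /negP/negPn/eqP -> : ~ (minor2 G i j != 0) by move=> m; apply: E; exists i, j.
by rewrite oppr0.
Qed.

(** Two rows with nonzero minor form an invertible matrix. A left inverse is the form in which
    linear independence of the two columns is used below. *)
Lemma left_inverse_plane G : plane G != 0 -> exists H : 'M[K]_(2, 8), H *m G = 1%:M.
Proof.
move=> Gn; have [i [j mij]] := minor2_neq0 Gn.
pose f (k : 'I_2) := if k == ord0 then i else j.
have u : rowsub f G \in unitmx by rewrite unitmxE det22 !mxE unitfE.
exists (invmx (rowsub f G) *m rowsub f 1%:M).
by rewrite -mulmxA mul_rowsub_mx mul1mx mulVmx.
Qed.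

Lemma plane_neq0 G (H : 'M[K]_(2, 8)) : H *m G = 1%:M -> plane G != 0.
Proof.
move=> HG; apply/eqP => /(congr1 (fun M => H *m (M *m (J *m H^T)))).
rewrite /plane mul0mx mulmx0 mulNmx mulmxN -!mulmxA (mulmxA J) JJ mul1mx.
rewrite -trmx_mul HG trmx1 mulmx1 mulmxA HG mul1mx => /eqP.
rewrite oppr_eq0 => /eqP/matrixP/(_ ord0 ord_max).
by rewrite !mxE epsE => /eqP; rewrite oner_eq0.
Qed.

Lemma dplane_so8 A G : so8 A -> dplane G (A *m G) = lie A (plane G).
Proof.
move=> /so8P A0; rewrite /dplane /lie /plane trmx_mul mulmxN mulNmx opprK.
rewrite -[_ *m J in X in X + _]mulmxA -(mulmxA _ A^T) A0.
rewrite opprD addrC !mulmxA; congr (_ + _).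
by rewrite !mulmxN opprK !mulmxA.
Qed.

(** Infinitesimal Witt theorem. [J W] lies in so_8 exactly when [W] is antisymmetric. In [W], the
    term [V H] gives the right value on [G], the second makes it antisymmetric, and the third,
    antisymmetric by tangency, restores the value on [G]. *)
Lemma isotangent_witt (G U : 'M[K]_(8, 2)) (H : 'M[K]_(2, 8)) :
  H *m G = 1%:M -> isotangent G U -> exists2 A, so8 A & A *m G = U.
Proof.
move=> HG; rewrite /isotangent -!mulmxA.
set V := J *m U => T0.
pose W := V *m H - H^T *m V^T - H^T *m (G^T *m V) *m H.
have VG : V^T *m G = - (G^T *m V).
  by apply/eqP; rewrite -addr_eq0 addrC /V trmx_mul trJ -mulmxA T0.
have WG : W *m G = V.
  rewrite /W !mulmxBl -!mulmxA HG !mulmx1 VG mulmxN opprK.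
  by rewrite addrK.
exists (J *m W); last by rewrite -mulmxA WG /V mulmxA JJ mul1mx.
apply/so8P; rewrite trmx_mul trJ -mulmxA !mulmxA JJ mul1mx -mulmxA JJ mulmx1.
have GVT : (G^T *m V)^T = - (G^T *m V) by rewrite trmx_mul trmxK VG.
have trB (A B : 'M[K]_8) : (A - B)^T = A^T - B^T by exact: linearB.
rewrite /W !trB !(trmx_mul _ H) !(trmx_mul H^T) GVT !trmxK.
by rewrite mulNmx mulmxN opprK !opprB [RHS]addrC !mulmxA.
Qed.


Lemma planeD_scale G U s :
  plane (G + s *: U) = plane G + s *: dplane G U + s ^+ 2 *: plane U.
Proof.
have trD : (G + s *: U)^T = G^T + s *: U^T by rewrite linearD linearZ.
rewrite /plane /dplane trD.
rewrite !(mulmxDl, mulmxDr) -!(scalemxAl, scalemxAr) scalerA -expr2.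
rewrite !scalerN -!opprD; congr (- _).
by rewrite scalerDr !addrA; congr (_ + _); rewrite addrAC.
Qed.

Lemma dplane_linear G a U V :
  dplane G (a *: U + V) = a *: dplane G U + dplane G V.
Proof.
have trD : (a *: U + V)^T = a *: U^T + V^T by rewrite linearD linearZ.
rewrite /dplane trD; rewrite !(mulmxDl, mulmxDr) -!(scalemxAl, scalemxAr).
by rewrite scalerN scalerDr -opprD; congr (- _); rewrite !addrA; congr (_ + _); rewrite addrAC.
Qed.

(** Each of the products [A B] and [B A] contributes the same pairing of [A G] and [B G], because
    exchanging [A] and [B] changes its sign. This is the origin of the factor 2. *)
Lemma kappa_plane_lie G A B : so8 A -> so8 B ->
  kappa (plane G) (lie A B) = \tr (eps *m (A *m G)^T *m J *m (B *m G)) *+ 2.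
Proof.
move=> /so8P A0 /so8P B0.
have E (A' B' : 'M[K]_8) : A'^T *m J = - (J *m A') ->
    \tr (plane G *m (A' *m B')) = \tr (eps *m (A' *m G)^T *m J *m (B' *m G)).
  move=> A'0; rewrite /plane mulNmx -!mulmxA mxtrace_mulC.
  rewrite trmx_mul -!mulmxA (mulmxA A'^T) A'0.
  by rewrite mulNmx mulmxN !raddfN /= mulmxA mxtrace_mulC !mulmxA.
rewrite /kappa /lie mulmxBr raddfB /= !E //.
rewrite mulr2n; congr (_ + _); apply/eqP; rewrite eqr_oppLR; apply/eqP.
rewrite -[LHS]mxtrace_tr !trmx_mul !trmxK trE trJ !mulmxN raddfN /=.
by congr (- _); rewrite !mulmxA mxtrace_mulC !mulmxA.
Qed.

Lemma wedge8_plane G : wedge8 (col ord0 G) (col ord_max G) = plane G.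
Proof.
rewrite /wedge8 /plane !mulmxA -mulmxBl -[RHS]mulNmx; congr (_ *m _).
apply/matrixP => i j; rewrite !mxE !sum_ord2 !big_ord1 !mxE !sum_ord2 !epsE.
by ring.
Qed.

Lemma SO8_unit (g : 'M[K]_8) : SO8 g -> g \in unitmx.
Proof. by move=> [_ g1]; rewrite unitmxE g1 unitr1. Qed.

Lemma SO8_trJ (g : 'M[K]_8) : SO8 g -> g^T *m J = J *m invmx g.
Proof. by move=> Sg; rewrite -[LHS](mulmxK (SO8_unit Sg)) (proj1 Sg). Qed.

Lemma plane_orbit g G : SO8 g -> plane (g *m G) = g *m plane G *m invmx g.
Proof.
move=> Sg; rewrite /plane mulmxN mulNmx; congr (- _); rewrite trmx_mul !mulmxA.
by rewrite -(mulmxA _ g^T) SO8_trJ // !mulmxA.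
Qed.

Lemma dplane_orbit g G U : SO8 g ->
  dplane (g *m G) (g *m U) = g *m dplane G U *m invmx g.
Proof.
move=> Sg; rewrite /dplane mulmxN mulNmx; congr (- _).
rewrite !trmx_mul mulmxDr mulmxDl !mulmxA.
by rewrite -!(mulmxA _ g^T) SO8_trJ // !mulmxA.
Qed.

Lemma form_SO8 g (G U : 'M[K]_(8, 2)) : SO8 g ->
  (g *m G)^T *m J *m (g *m U) = G^T *m J *m U.
Proof.
by move=> [gJ _]; rewrite trmx_mul !mulmxA -(mulmxA _ g^T) -(mulmxA _ _ g) gJ.
Qed.

Lemma isotropic_orbit g G : SO8 g -> isotropic G -> isotropic (g *m G).
Proof. by move=> Sg; rewrite /isotropic form_SO8. Qed.

Lemma isotangent_orbit g G U : SO8 g ->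
  isotangent (g *m G) (g *m U) <-> isotangent G U.
Proof. by move=> Sg; rewrite /isotangent !form_SO8. Qed.

Lemma planeJE G : plane G *m J = - (G *m eps *m G^T).
Proof. by rewrite /plane mulNmx -(mulmxA _ J) JJ mulmx1. Qed.

Lemma dplaneJE G U :
  dplane G U *m J = - (G *m eps *m U^T + U *m eps *m G^T).
Proof. by rewrite /dplane mulNmx mulmxDl -!(mulmxA _ J J) JJ !mulmx1. Qed.

(** Pluecker relations in matrix form: both sides equal [\det (X^T G)] times [G eps G^T]. Being
    quadratic in [S] for each fixed [X], they can be polarised to constrain tangent vectors. *)
Lemma plucker G (X : 'M[K]_(8, 2)) (S := plane G *m J) :
  (X^T *m S *m X) ord0 ord_max *: S = S *m X *m eps *m X^T *m S^T.
Proof.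
have -> : S = - (G *m eps *m G^T) by rewrite /S planeJE.
pose a := X^T *m G.
have -> : X^T *m - (G *m eps *m G^T) *m X = - (\det a *: eps).
  by rewrite -eps_congr mulmxN mulNmx /a trmx_mul trmxK !mulmxA.
have -> : - (G *m eps *m G^T) *m X *m eps *m X^T *m (- (G *m eps *m G^T))^T =
   G *m eps *m (a^T *m eps *m a) *m eps^T *m G^T.
  have -> : (- (G *m eps *m G^T))^T = - (G *m eps^T *m G^T).
    by rewrite linearN /= !trmx_mul trmxK !mulmxA.
  by rewrite !mulNmx mulmxN opprK /a trmx_mul trmxK !mulmxA.
rewrite eps_congr_tr mxE trE -!(scalemxAl, scalemxAr) mulmxN mulNmx.
rewrite -(mulmxA G eps eps) epseps mulmxN mulmx1 !mulNmx.
by rewrite mxE epsE mulr1 scaleNr scalerN !opprK.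
Qed.

(** For [X = H^T] the coefficient of [T] in the polarised relation is -1, so the relation expresses
    [T] through [T X] and a multiple of [S]. The first part comes from [U = T X eps], the second
    from a multiple of [G]. *)
Lemma plucker_tangent G (H : 'M[K]_(2, 8)) (B : 'M[K]_8)
    (S := plane G *m J) (T := B *m J) (X := H^T) : H *m G = 1%:M ->
  (X^T *m T *m X) ord0 ord_max *: S + (X^T *m S *m X) ord0 ord_max *: T =
  T *m X *m eps *m X^T *m S^T + S *m X *m eps *m X^T *m T^T ->
  exists U, B = dplane G U.
Proof.
move=> HG; have SE : S = - (G *m eps *m G^T).
  by rewrite /S planeJE.
have GX : G^T *m X = 1%:M by rewrite /X -trmx_mul HG trmx1.
have -> : X^T *m S *m X = - eps.
  by rewrite SE mulmxN mulNmx -!mulmxA GX mulmx1 mulmxA /X trmxK HG mul1mx.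
have -> : S *m X = - (G *m eps) by rewrite SE mulNmx -!mulmxA GX mulmx1.
have -> : T *m X *m eps *m X^T *m S^T = - (T *m X *m G^T).
  rewrite SE linearN /= !trmx_mul trmxK trE /X trmxK mulmxN !mulmxA.
  rewrite -(mulmxA _ H G) HG mulmx1 mulmxN mulNmx opprK.
  by rewrite -(mulmxA _ eps eps) epseps mulmxN mulmx1 mulNmx.
have -> : - (G *m eps) *m eps *m X^T *m T^T = G *m X^T *m T^T.
  by rewrite !mulNmx -(mulmxA G eps eps) epseps mulmxN mulmx1 !mulNmx opprK.
set tau := (X^T *m T *m X) ord0 ord_max.
rewrite mxE epsE scaleN1r => E.
(* Moving [G] in the direction [G d], with [d] of trace 1, changes the bivector by a multiple of
   itself, which accounts for the term [tau *: S]. *)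
pose d : 'M[K]_2 := delta_mx ord0 ord0.
have dE : d *m eps + eps *m d = eps.
  by apply: mx22P; rewrite !mxE !sum_ord2 !mxE !epsE /=; ring.
have trd : d^T = d by rewrite trmx_delta.
pose U := T *m X *m eps + G *m (tau *: d).
exists U; rewrite -[B]mulmx1 -[dplane G U]mulmx1 -JJ !mulmxA -/T; congr (_ *m J).
rewrite dplaneJE.
have -> : U^T = - (eps *m X^T *m T^T) + tau *: (d *m G^T).
  rewrite /U linearD /= !trmx_mul trE linearZ /= trd mulNmx -scalemxAl.
  by rewrite !mulmxA.
have e2 (A : 'M[K]_(8, 2)) (B' : 'M[K]_(2, 8)) : A *m eps *m eps *m B' = - (A *m B').
  by rewrite -(mulmxA A) epseps mulmxN mulmx1 mulNmx.
have GdG : G *m eps *m d *m G^T + G *m d *m eps *m G^T = G *m eps *m G^T.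
  by rewrite -!(mulmxA G) -mulmxDr -mulmxDl addrC dE.
transitivity (tau *: S - (- (T *m X *m G^T) + G *m X^T *m T^T)).
  by rewrite -E opprB addrC subrK.
rewrite /U SE mulmxDl mulmxDr mulmxN !mulmxA e2 mulmxDl -!(scalemxAl, scalemxAr).
rewrite -GdG !opprD !opprK (mulmxA _ d) e2 opprK mulNmx.
by rewrite scalerDr !scalerN [LHS]addrC (addrC (_ *m G^T)) addrACA.
Qed.

End IsotropicPlanes.

(** * The equation of square zero, spanning of so_8, and transvections *)

Section Connectedness.
Variable K : numFieldType.
Local Notation J := (J8 K).
Local Notation eps := (eps K).

(** As [G] is isotropic, both products collapse to [G eps _ eps G^T J] around the two halves of the
    tangency condition. The outer factors are cancelled by [H] and [J H^T], and [eps] is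
    invertible. *)
Lemma isotangent_sq (G U : 'M[K]_(8, 2)) (H : 'M[K]_(2, 8)) :
  H *m G = 1%:M -> isotropic G ->
  plane G *m dplane G U + dplane G U *m plane G = 0 -> isotangent G U.
Proof.
move=> HG G0 E.
have E1 : plane G *m dplane G U = G *m eps *m (G^T *m J *m U) *m eps *m G^T *m J.
  rewrite /plane /dplane mulmxN mulNmx opprK mulmxDr !mulmxA.
  by rewrite -!(mulmxA _ J G) -(mulmxA _ G^T (J *m G)) (mulmxA G^T) G0 mulmx0 !mul0mx add0r.
have E2 : dplane G U *m plane G = G *m eps *m (U^T *m J *m G) *m eps *m G^T *m J.
  rewrite /plane /dplane mulmxN mulNmx opprK mulmxDl !mulmxA.
  by rewrite -!(mulmxA _ J G) -(mulmxA _ G^T (J *m G)) (mulmxA G^T) G0 mulmx0 !mul0mx addr0.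
have GH : G^T *m J *m (J *m H^T) = 1%:M.
  by rewrite mulmxA -(mulmxA _ J J) JJ mulmx1 -trmx_mul HG trmx1.
have {}E : eps *m (G^T *m J *m U + U^T *m J *m G) *m eps = 0.
  have /(congr1 (fun M => H *m (M *m (J *m H^T)))) := E.
  rewrite E1 E2 -!mulmxDl -mulmxDr mul0mx mulmx0; set X := _ + _.
  by rewrite -!mulmxA (mulmxA G^T J) GH mulmx1 (mulmxA H G) HG mul1mx !mulmxA.
rewrite /isotangent; move: (_ + _) E => X E.
have /(congr1 (fun M => eps *m (M *m eps))) := E.
rewrite mul0mx mulmx0 -!mulmxA epseps mulmxN mulmx1 !mulmxN mulmxA epseps mulNmx mul1mx.
by rewrite opprK.
Qed.


Lemma wedge8Dl (a b c : 'cV[K]_8) :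
  wedge8 (a + b) c = wedge8 a c + wedge8 b c.
Proof.
have trD : (a + b)^T = a^T + b^T by exact: linearD.
by rewrite /wedge8 trD !(mulmxDl, mulmxDr) opprD addrACA.
Qed.

Lemma wedge8C (a b : 'cV[K]_8) : wedge8 a b = - wedge8 b a.
Proof. by rewrite /wedge8 opprB. Qed.

Lemma wedge8Dr (a b c : 'cV[K]_8) :
  wedge8 a (b + c) = wedge8 a b + wedge8 a c.
Proof. by rewrite wedge8C wedge8Dl opprD -!wedge8C. Qed.

Lemma wedge8Nr (a b : 'cV[K]_8) : wedge8 a (- b) = - wedge8 a b.
Proof.
by apply/eqP; rewrite -addr_eq0 -wedge8Dr addNr /wedge8 mul0mx trmx0 mul0mx mulmx0 subr0.
Qed.

Definition colpair (a b : 'cV[K]_8) : 'M[K]_(8, 2) :=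
  \matrix_(i, j) if j == ord0 then a i ord0 else b i ord0.

Lemma col_colpair a b : (col ord0 (colpair a b) = a) * (col ord_max (colpair a b) = b).
Proof. by split; apply/colP => i; rewrite !mxE. Qed.

Lemma plane_colpair a b : plane (colpair a b) = wedge8 a b.
Proof. by rewrite -wedge8_plane !col_colpair. Qed.

Definition form8 (a b : 'cV[K]_8) : K := (a^T *m J *m b) ord0 ord0.

Lemma form8Dl a b c : form8 (a + b) c = form8 a c + form8 b c.
Proof.
have trD : (a + b)^T = a^T + b^T by exact: linearD.
by rewrite /form8 trD !mulmxDl mxE.
Qed.

Lemma form8Dr a b c : form8 a (b + c) = form8 a b + form8 a c.
Proof. by rewrite /form8 mulmxDr mxE. Qed.

Lemma form8Nr a b : form8 a (- b) = - form8 a b.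
Proof. by rewrite /form8 mulmxN mxE. Qed.

Lemma form8C a b : form8 a b = form8 b a.
Proof.
have -> : form8 b a = (b^T *m J *m a)^T ord0 ord0 by rewrite mxE.
by rewrite !trmx_mul trmxK trJ mulmxA.
Qed.

Lemma form8Nl a b : form8 (- a) b = - form8 a b.
Proof. by rewrite form8C form8Nr form8C. Qed.

Lemma form8_col (G U : 'M[K]_(8, 2)) i j :
  (G^T *m J *m U) i j = form8 (col i G) (col j U).
Proof.
rewrite /form8 -!mulmxA !mxE; apply: eq_bigr => k _; rewrite !mxE; congr (_ * _).
by apply: eq_bigr => l _; rewrite !mxE.
Qed.

Lemma isotropic_colpair a b :
  isotropic (colpair a b) <-> [/\ form8 a a = 0, form8 b b = 0 & form8 a b = 0].
Proof.
split=> [G0|[aa bb ab]].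
  have E i j := congr1 (fun M : 'M[K]_2 => M i j) G0.
  have := (E ord0 ord0, E ord_max ord_max, E ord0 ord_max).
  by rewrite /= !form8_col !col_colpair !mxE => -[[-> ->] ->].
by apply: mx22P; rewrite form8_col !col_colpair mxE // form8C.
Qed.

Local Notation e i := (delta_mx i ord0 : 'cV[K]_8).

Lemma form8_delta i j : form8 (e i) (e j) = (i + j == 7)%N%:R.
Proof.
rewrite /form8 trmx_delta -mulmxA mulmxA -rowE !mxE (bigD1 j) //= big1 => [|k kj].
  by rewrite !mxE !eqxx mulr1 addr0.
by rewrite !mxE (negPf kj) mulr0.
Qed.

Lemma wedge8_delta i j :
  wedge8 (e i) (e j) = (delta_mx j i - delta_mx i j) *m J.
Proof.
by rewrite /wedge8 !trmx_delta !mulmxA !mul_delta_mx mulmxBl.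
Qed.

(* The root vectors span so_8 modulo the torus, whose elements arise from
   [e_i + e_k] and [e_j - e_k'], where [j], [k'] are opposite to [i], [k]. *)
Lemma so8_isotropic_ind (P : 'M[K]_8 -> Prop) :
  (forall a A B, P A -> P B -> P (a *: A + B)) ->
  (forall G, isotropic G -> P (plane G)) -> forall A, so8 A -> P A.
Proof.
move=> PD PG; have P0 : P 0.
  have -> : 0 = plane 0 :> 'M[K]_8 by rewrite /plane !mul0mx oppr0.
  by apply: PG; rewrite /isotropic mulmx0.
have PZ a A : P A -> P (a *: A) by move=> PA; rewrite -[_ *: _]addr0; apply: PD.
have PA A B : P A -> P B -> P (A + B) by move=> ? ?; rewrite -[A]scale1r; apply: PD.
have PN A : P A -> P (- A) by rewrite -scaleN1r; apply: PZ.
have Pw a b : form8 a a = 0 -> form8 b b = 0 -> form8 a b = 0 -> P (wedge8 a b).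
  by move=> *; rewrite -plane_colpair; apply/PG/isotropic_colpair.
have Pij (i j : 'I_8) : (i + j != 7)%N -> P (wedge8 (e i) (e j)).
  have [->|ij] := eqVneq i j; first by rewrite /wedge8 subrr.
  move=> ij7; apply: Pw; rewrite form8_delta (negPf (_ : (_ + _ != 7)%N)) //.
    by case: (i) => ? ? /=; lia.
  by case: (j) => ? ? /=; lia.
have {}Pij (i j : 'I_8) : P (wedge8 (e i) (e j)).
  have [ij7|] := eqVneq (i + j)%N 7%N; last exact: Pij.
  have [k /andP[ik jk]] : exists k : 'I_8, (k != i :> nat) && (k != j :> nat).
    have [i0|] := boolP ((i == 0 :> nat) || (j == 0 :> nat)).
      by exists (inord 1); rewrite inordK //; move: i0 ij7; case: (i) (j) => ? ? [? ?] /=; lia.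
    by move=> ij0; exists ord0; move: ij0 ij7; case: (i) (j) => ? ? [? ?] /=; lia.
  have [k' kk'] : exists k' : 'I_8, (k + k')%N = 7%N.
    by exists (rev_ord k); case: (k) => ? ? /=; lia.
  (* Adding the expansions for [k] and for [k'] cancels [e_k /\ e_k'] against [e_k' /\ e_k]; the
     remaining cross terms are root vectors. *)
  have -> : wedge8 (e i) (e j) = 2^-1 *: (wedge8 (e i + e k) (e j - e k')
     + wedge8 (e i + e k') (e j - e k) + wedge8 (e i) (e k') - wedge8 (e k) (e j)
     + wedge8 (e i) (e k) - wedge8 (e k') (e j)).
    rewrite !(wedge8Dl, wedge8Dr, wedge8Nr) (wedge8C (e k') (e k)).
    apply: (@scalerI _ _ 2); first by rewrite pnatr_eq0.
    rewrite scalerA divff ?pnatr_eq0 // scale1r.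
    apply/matrixP => r c; rewrite !mxE; ring.
  apply: PZ.
  have lt8 := (ltn_ord i, ltn_ord j, ltn_ord k, ltn_ord k').
  refine (PA _ _ (PA _ _ (PA _ _ (PA _ _ (PA _ _ (Pw _ _ _ _ _) (Pw _ _ _ _ _))
    (Pij _ _ _)) (PN _ (Pij _ _ _))) (Pij _ _ _)) (PN _ (Pij _ _ _))); try lia;
    rewrite !(form8Dl, form8Dr, form8Nl, form8Nr, form8_delta);
    by repeat (case: eqP => ?; try lia); rewrite /=; ring.
move=> A /so8P A0; pose S := A *m J.
have trS : S^T = - S.
  rewrite /S trmx_mul trJ -[A^T]mulmx1 -JJ !mulmxA -(mulmxA J) A0.
  by rewrite mulmxN mulNmx !mulmxA JJ mul1mx.
have -> : A = 2^-1 *: \sum_i \sum_j S i j *: wedge8 (e j) (e i).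
  apply: (@scalerI _ _ 2); first by rewrite pnatr_eq0.
  rewrite scalerA divff ?pnatr_eq0 // scale1r.
  have -> : \sum_i \sum_j S i j *: wedge8 (e j) (e i) = (S - S^T) *m J.
    under eq_bigr => i _ do under eq_bigr => j _ do
      rewrite wedge8_delta scalemxAl scalerBr.
    under eq_bigr => i _ do rewrite -mulmx_suml.
    rewrite -mulmx_suml; congr (_ *m J).
    under eq_bigr => i _ do rewrite big_split.
    rewrite big_split /= -matrix_sum_delta; congr (_ + _).
    rewrite (matrix_sum_delta S^T) exchange_big -sumrN; apply: eq_bigr => i _.
    by rewrite -sumrN; apply: eq_bigr => j _; rewrite [S^T _ _]mxE.
  by rewrite trS opprK mulmxDl scaler_nat mulr2n -(mulmxA A) JJ mulmx1.
by apply: (PZ); do 2!(apply: (big_ind P) => [||? _] //); apply/PZ/Pij.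
Qed.


(** [A] lies in so_8 and squares to zero, so [1 + s A] is its exponential and preserves the form. *)
Lemma transvection_form G' (X Y : 'M[K]_(8, 2)) s (A := plane G') :
  isotropic G' ->
  (X + s *: (A *m X))^T *m J *m (Y + s *: (A *m Y)) = X^T *m J *m Y.
Proof.
move=> G0; have /so8P AJ := so8_plane G'; rewrite -/A in AJ.
have AA : A *m A = 0 by exact: plane_sq.
have -> : (X + s *: (A *m X))^T *m J = X^T *m J - s *: (X^T *m J *m A).
  have -> : (X + s *: (A *m X))^T = X^T + s *: (X^T *m A^T).
    by rewrite linearD linearZ /= trmx_mul.
  by rewrite mulmxDl -scalemxAl -mulmxA AJ mulmxN mulmxA scalerN.
rewrite mulmxBl !mulmxDr -!(scalemxAl, scalemxAr) !mulmxA -(mulmxA _ A A) AA.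
by rewrite mulmx0 mul0mx !scaler0 addr0 addrK.
Qed.

Lemma isotropic_transvection (G' G : 'M[K]_(8, 2)) s : isotropic G' -> isotropic G ->
  isotropic (G + s *: (plane G' *m G)).
Proof. by move=> G'0; rewrite /isotropic transvection_form. Qed.

Lemma isotangent_transvection (G' G U : 'M[K]_(8, 2)) s : isotropic G' -> isotangent G U ->
  isotangent (G + s *: (plane G' *m G)) (U + s *: (plane G' *m U)).
Proof. by move=> G'0; rewrite /isotangent !transvection_form. Qed.

Definition rows2 (i j : 'I_8) : 'M[K]_(2, 8) :=
  rowsub (fun k => if k == ord0 then i else j) 1%:M.

Lemma det_rows2 i j G : \det (rows2 i j *m G) = minor2 G i j.
Proof. by rewrite det22 mul_rowsub_mx mul1mx !mxE. Qed.

(** The coefficient of degree 2 is recorded because its nonvanishing shows that the polynomial is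
    nonzero. *)
Lemma det22_line (M M' : 'M[K]_2) :
  exists2 p : {poly K}, p`_2 = \det M' & forall s, p.[s] = \det (M + s *: M').
Proof.
pose l i j : {poly K} := (M i j)%:P + M' i j *: 'X.
exists (l ord0 ord0 * l ord_max ord_max - l ord0 ord_max * l ord_max ord0).
  have E i j k m : (l i j * l k m)`_2 = M' i j * M' k m.
    rewrite coefM !big_ord_recl big_ord0 /= /l !coefD !coefC !coefZ !coefX /=; ring.
  by rewrite coefB !E det22.
by move=> s; rewrite !det22 !mxE /l !hornerE; ring.
Qed.

End Connectedness.

(** * Moving isotropic planes into general position *)

Section Generic.
Variable K : numFieldType.
Local Notation J := (J8 K).
Local Notation eps := (eps K).
Local Notation rows2 := (rows2 K).
Local Notation e i := (delta_mx i ord0 : 'cV[K]_8).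

Lemma formE (G U : 'M[K]_(8, 2)) i j :
  (G^T *m J *m U) i j = \sum_k G k i * U (rev_ord k) j.
Proof.
rewrite -mulmxA !mxE; apply: eq_bigr => k _; rewrite !mxE; congr (_ * _).
rewrite (bigD1 (rev_ord k)) //= big1 => [|l lk].
  by rewrite !mxE addr0 (_ : (_ + _ == 7)%N) ?mul1r //=; case: (k) => ? ? /=; lia.
rewrite !mxE; case: eqP => [E|]; last by rewrite mul0r.
by case/eqP: lk; apply: val_inj => /=; case: (l) (k) E => ? ? [? ?] /=; lia.
Qed.

(* The coefficients [1, -3, 3, -1] of the third difference operator annihilate
   every quadratic form evaluated at [(1, x)], [x = 0, 1, 2, 3]. *)
Definition Gstar_coef (i : 'I_8) : K :=
  nth 0 [:: 1; 1; 1; 1; - 1; 3; - 3; 1] i.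

Definition Gstar_abs (i : 'I_8) : nat := nth 0%N [:: 0; 1; 2; 3; 3; 2; 1; 0]%N i.

Definition Gstar : 'M[K]_(8, 2) := \matrix_(i, j)
  (Gstar_coef i * if j == ord0 then 1 else (Gstar_abs i)%:R).

Lemma isotropic_Gstar : isotropic Gstar.
Proof.
by apply: mx22P; rewrite formE !big_ord_recl big_ord0 !mxE /Gstar_coef /Gstar_abs /=; ring.
Qed.

(** A minor is a product of nonzero coefficients and a difference of abscissae, and distinct rows
    share an abscissa only when they are opposite. *)
Lemma minor2_Gstar (i j : 'I_8) : i != j -> (i + j != 7)%N -> minor2 Gstar i j != 0.
Proof.
move=> ij ij7; have c0 k : Gstar_coef k != 0.
  case: k => -[|[|[|[|[|[|[|[|]]]]]]]] // ?; rewrite /Gstar_coef /=;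
  by rewrite ?oppr_eq0 ?oner_eq0 ?pnatr_eq0.
have -> : minor2 Gstar i j = Gstar_coef i * Gstar_coef j *
    ((Gstar_abs j)%:R - (Gstar_abs i)%:R).
  by rewrite /minor2 !mxE /=; ring.
have absE (k : 'I_8) : Gstar_abs k = minn k (7 - k).
  by case: k => -[|[|[|[|[|[|[|[|]]]]]]]].
rewrite !mulf_neq0 // subr_eq0 eqr_nat !absE.
by move: ij ij7; case: (i) (j) => ? ? [? ?]; rewrite -val_eqE /=; lia.
Qed.

Lemma rows2J i j : rows2 i j *m J = rows2 (rev_ord i) (rev_ord j).
Proof.
rewrite mul_rowsub_mx mul1mx; apply/matrixP => a k; rewrite !mxE.
congr (_%:R); congr nat_of_bool; case: ifP => _; rewrite -val_eqE /=.
  by case: (i) (k) => ? ? [? ?] /=; lia.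
by case: (j) (k) => ? ? [? ?] /=; lia.
Qed.

Lemma tr_colpair_delta i j : (colpair (e i) (e j))^T = rows2 i j.
Proof.
by apply/matrixP => a k; rewrite !mxE; case: ifP => _; rewrite ?mxE eqxx andbT eq_sym.
Qed.

(** If only minors on opposite rows [i], [j] were nonzero, the relation expressing [minor2 G i j]
    times a row [k] through the minors of [k] with [i] and [j] would kill all other rows. The
    columns would span the hyperbolic plane of [e_i] and [e_j], which is not isotropic. *)
Lemma isotropic_minor (G : 'M[K]_(8, 2)) : isotropic G -> plane G != 0 ->
  exists i j : 'I_8, [/\ i != j, (i + j != 7)%N & minor2 G i j != 0].
Proof.
move=> G0 Gn; apply: contrapT => noij.
have m0 (i j : 'I_8) : (i + j != 7)%N -> minor2 G i j = 0.
  move=> ij7; apply/eqP/negPn/negP => mij; apply: noij; exists i, j; split=> //.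
  by apply: contra_neq mij => ->; rewrite /minor2 mulrC subrr.
have [i [j mij]] := minor2_neq0 Gn.
have ij7 : (i + j)%N = 7%N by apply/eqP; apply: contraNT mij => /m0 ->.
have jE : j = rev_ord i by apply: val_inj; case: (i) (j) ij7 => ? ? [? ?] /=; lia.
have row0 k l : k != i -> k != j -> G k l = 0.
  move=> ki kj; have := m0 i k; have := m0 j k.
  rewrite /minor2 => H1 H2.
  have {}H1 : G j ord0 * G k ord_max - G j ord_max * G k ord0 = 0.
    by apply: H1; move: ki; rewrite -val_eqE /=; lia.
  have {}H2 : G i ord0 * G k ord_max - G i ord_max * G k ord0 = 0.
    by apply: H2; move: kj; rewrite -val_eqE /=; lia.
  have [] : minor2 G i j * G k ord0 = 0 /\ minor2 G i j * G k ord_max = 0.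
    split.
      rewrite (_ : _ * _ =
          G j ord0 * (G i ord0 * G k ord_max - G i ord_max * G k ord0)
          - G i ord0 * (G j ord0 * G k ord_max - G j ord_max * G k ord0)).
        by rewrite H1 H2 !mulr0 subr0.
      by rewrite /minor2; ring.
    rewrite (_ : _ * _ =
        G j ord_max * (G i ord0 * G k ord_max - G i ord_max * G k ord0)
        - G i ord_max * (G j ord0 * G k ord_max - G j ord_max * G k ord0)).
      by rewrite H1 H2 !mulr0 subr0.
    by rewrite /minor2; ring.
  move=> /eqP; rewrite mulf_eq0 (negPf mij) => /= /eqP E0.
  move=> /eqP; rewrite mulf_eq0 (negPf mij) => /= /eqP E1.
  by case: l => -[|[|]] // h; [rewrite -E0|rewrite -E1]; congr (G k _); apply: val_inj.
have ji : j != i by apply: contra_neq mij => ->; rewrite /minor2 mulrC subrr.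
have F a b : G i a * G j b + G j a * G i b = 0.
  have <- : (G^T *m J *m G) a b = 0 by rewrite G0 mxE.
  rewrite formE (bigD1 i) //= (bigD1 j) //= big1 => [|k /andP[ki kj]].
    by rewrite addr0 jE rev_ordK.
  by rewrite row0 ?mul0r.
have := (F ord0 ord0, F ord_max ord_max, F ord0 ord_max).
have two : (2 : K) != 0 by rewrite pnatr_eq0.
case=> [[F0 F1] F01]; case/eqP: mij; rewrite /minor2.
have E0 : G i ord0 * G j ord0 = 0.
  by apply: (mulfI two); rewrite mulr0 -F0; ring.
have E1 : G i ord_max * G j ord_max = 0.
  by apply: (mulfI two); rewrite mulr0 -F1; ring.
have := F01; move/eqP: E0; rewrite mulf_eq0 => /orP[] /eqP ->.
  by rewrite !mul0r add0r => E2; rewrite sub0r mulrC E2 oppr0.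
rewrite !mul0r addr0 mulr0 subr0 => ->; exact: erefl.
Qed.

(** Guarantees that [Finv G] lies in [Ninj]: rows 1 and 2 are the first two rows of [alpha2], and
    row 4 holds the entries of [alpha1] up to order and sign. *)
Definition good (G : 'M[K]_(8, 2)) : Prop :=
  minor2 G (inord 1) (inord 2) != 0 /\ exists l, G (inord 4) l != 0.

(** [plane G' *m G] equals [G'] times [- eps (G'^T J G)], so its minors are those of [G'] times one
    determinant. The same factorisation gives [line_pairing]. *)
Lemma line_minor2 (G G' : 'M[K]_(8, 2)) i j :
  exists2 p : {poly K}, p`_2 = minor2 G' i j * \det (G'^T *m J *m G) &
    forall s, p.[s] = minor2 (G + s *: (plane G' *m G)) i j.
Proof.
have [p p2 pE] := det22_line (rows2 i j *m G) (rows2 i j *m (plane G' *m G)).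
exists p; last by move=> s; rewrite pE -det_rows2 mulmxDr -scalemxAr.
rewrite p2 /plane mulNmx mulmxN -!mulmxA (mulmxA _ G') (mulmxA G'^T J) -mulmxN.
by rewrite det_mulmx det_rows2 -scaleN1r detZ det_mulmx det_eps mul1r sqrrN expr1n mul1r.
Qed.

Lemma line_pairing (G0 G G' : 'M[K]_(8, 2)) :
  exists2 p : {poly K},
    p`_2 = \det (G0^T *m J *m G') * \det (G'^T *m J *m G) &
    forall s, p.[s] = \det (G0^T *m J *m (G + s *: (plane G' *m G))).
Proof.
have [p p2 pE] := det22_line (G0^T *m J *m G) (G0^T *m J *m (plane G' *m G)).
exists p; last by move=> s; rewrite pE mulmxDr -scalemxAr.
have E : G0^T *m J *m (plane G' *m G) =
    G0^T *m J *m G' *m - (eps *m (G'^T *m J *m G)).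
  by rewrite /plane mulNmx !mulmxN !mulmxA.
by rewrite p2 E det_mulmx -scaleN1r detZ det_mulmx det_eps mul1r sqrrN expr1n mul1r.
Qed.

(* A generic [1 + s plane G'], with [G'] a coordinate plane, moves any isotropic
   plane into general position with [Gstar]; a generic [1 + s plane Gstar] then
   moves it to a good one. *)
Lemma isotropic_connected (P : 'M[K]_(8, 2) -> Prop) :
  (forall G G' (D : {poly K}), isotropic G -> plane G != 0 -> isotropic G' ->
     D != 0 -> (forall s, D.[s] != 0 -> P (G + s *: (plane G' *m G))) -> P G) ->
  (forall G, isotropic G -> good G -> P G) ->
  forall G, isotropic G -> plane G != 0 -> P G.
Proof.
move=> Pline Pgood.
have P1 G : isotropic G -> \det (Gstar^T *m J *m G) != 0 -> P G.
  move=> G0 GG; set B := Gstar^T *m J *m G in GG.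
  have [p p2 pE] := line_minor2 G Gstar (inord 1) (inord 2).
  have m12 : minor2 Gstar (inord 1) (inord 2) != 0.
    by apply: minor2_Gstar; rewrite -?val_eqE /= !inordK.
  (* [plane Gstar *m G] is [Gstar] times an invertible matrix, so if its row 4 vanished, so would
     row 4 of [Gstar]. *)
  have [l bl] : exists l, (plane Gstar *m G) (inord 4) l != 0.
    apply: contrapT => E.
    have r0 : row (inord 4) (plane Gstar *m G) = 0.
      apply/rowP => l; rewrite !mxE; apply/eqP/negPn/negP => bl; apply: E.
      by exists l; rewrite mxE.
    have u : eps *m B \in unitmx by rewrite unitmxE det_mulmx det_eps mul1r unitfE.
    have : row (inord 4) Gstar = 0.
      have E' : plane Gstar *m G = - (Gstar *m (eps *m B)).
        by rewrite /plane /B mulNmx !mulmxA.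
      move: r0; rewrite E' rowE mulmxN => /eqP.
      rewrite oppr_eq0 mulmxA => /eqP/(congr1 (mulmx^~ (invmx (eps *m B)))).
      by rewrite mulmxK // mul0mx -rowE.
    move=> /rowP/(_ ord0); rewrite !mxE /Gstar_coef inordK //= mulr1.
    by move/eqP; rewrite oppr_eq0 oner_eq0.
  pose q : {poly K} := (G (inord 4) l)%:P + (plane Gstar *m G) (inord 4) l *: 'X.
  apply: (Pline G Gstar (p * q)) => //.
  - apply: (@plane_neq0 _ _ (invmx B *m (Gstar^T *m J))).
    by rewrite -mulmxA mulVmx // unitmxE unitfE.
  - exact: isotropic_Gstar.
  - rewrite mulf_neq0 //.
      apply/eqP => /(congr1 (fun r : {poly K} => r`_2)); rewrite p2 coef0 => /eqP.
      by rewrite mulf_eq0 (negPf m12) (negPf GG).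
    apply/eqP => /(congr1 (fun r : {poly K} => r`_1)).
    by rewrite coefD coefC coefZ coefX mulr1 add0r coef0 => /eqP; rewrite (negPf bl).
  move=> s; rewrite hornerM mulf_eq0 negb_or pE => /andP[ms qs].
  apply: Pgood; first exact/isotropic_transvection/G0/isotropic_Gstar.
  split=> //; exists l; rewrite !hornerE in qs.
  by apply: contra_neq qs => <-; rewrite !mxE; congr (_ + _); rewrite mulrC.
move=> G G0 Gn; have [i [j [ij ij7 mij]]] := isotropic_minor G0 Gn.
(* With opposite indices, [Gc^T J] extracts rows [i] and [j]; both factors of the leading
   coefficient of [p] are then nonzero minors, one of [Gstar] and one of [G]. *)
pose Gc := colpair (e (rev_ord i)) (e (rev_ord j)).
have GcJ : Gc^T *m J = rows2 i j by rewrite tr_colpair_delta rows2J !rev_ordK.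
have Gc0 : isotropic Gc.
  apply/isotropic_colpair; rewrite !form8_delta /=; split; apply/eqP;
  by rewrite pnatr_eq0 eqb0; case: (i) (j) ij ij7 => ? ? [? ?]; rewrite -val_eqE /=; lia.
have [p p2 pE] := line_pairing Gstar G Gc.
have GcGs : \det (Gstar^T *m J *m Gc) != 0.
  by rewrite -det_tr !trmx_mul trmxK trJ mulmxA GcJ det_rows2 minor2_Gstar.
apply: (Pline G Gc p) => //.
  apply/eqP => /(congr1 (fun r : {poly K} => r`_2)); rewrite p2 coef0 => /eqP.
  by rewrite mulf_eq0 (negPf GcGs) GcJ det_rows2 (negPf mij).
by move=> s ps; apply: P1; [exact: isotropic_transvection|rewrite -pE].
Qed.

End Generic.

(** * The quiver variety in terms of isotropic planes *)

Section QuiverPlanes.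
Variable K : numFieldType.
Local Notation J := (J8 K).
Local Notation eps := (eps K).

Lemma eta8E (z w : 'cV[K]_3) a b (i : 'I_8) : eta8 z a b w i ord0 =
  nth 0 [:: - w (inord 2) ord0; z (inord 0) ord0; z (inord 1) ord0; a; b;
    w (inord 1) ord0; w (inord 0) ord0; - z (inord 2) ord0] i.
Proof.
rewrite /eta8 !mxE /=.
by case: i => -[|[|[|[|[|[|[|[|]]]]]]]] // ?; rewrite -!val_eqE /= !inordK //=; ring.
Qed.

Definition Fmat (q : cotangentV K) : 'M[K]_(8, 2) :=
  \matrix_(i, j) F8 q (delta_mx j ord0) i ord0.

Definition Finv (G : 'M[K]_(8, 2)) : cotangentV K :=
  let g (i : nat) j := G (inord i) j in
  CotangentV
    (\col_i nth 0 [:: g 4%N ord_max; - g 4%N ord0] i)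
    (\matrix_(i, j) nth 0 [:: g 1%N j; g 2%N j; - g 7%N j] i)
    (\row_j - g 3%N j)
    (\matrix_(i, k) nth 0 (nth [::]
      [:: [:: g 6%N ord_max; g 5%N ord_max; - g 0%N ord_max];
          [:: - g 6%N ord0; - g 5%N ord0; g 0%N ord0]] i) k).

Lemma wedge2E (u v : 'cV[K]_2) : wedge2 u v =
  u ord0 ord0 * v ord_max ord0 - v ord0 ord0 * u ord_max ord0.
Proof.
have E0 i : (row_mx u v : 'M[K]_2) i ord0 = u i ord0.
  have -> : (ord0 : 'I_2) = lshift 1 (ord0 : 'I_1) by exact: val_inj.
  exact: row_mxEl.
have E1 i : (row_mx u v : 'M[K]_2) i ord_max = v i ord0.
  have -> : (ord_max : 'I_2) = rshift 1 (ord0 : 'I_1) by exact: val_inj.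
  exact: row_mxEr.
by rewrite /wedge2 det22 !E0 !E1.
Qed.

Lemma FmatE q i : (Fmat q i ord0 = nth 0
    [:: beta2 q ord_max (inord 2); alpha2 q (inord 0) ord0;
        alpha2 q (inord 1) ord0; - beta1 q ord0 ord0;
        - alpha1 q ord_max ord0; - beta2 q ord_max (inord 1);
        - beta2 q ord_max (inord 0); - alpha2 q (inord 2) ord0] i) *
  (Fmat q i ord_max = nth 0
    [:: - beta2 q ord0 (inord 2); alpha2 q (inord 0) ord_max;
        alpha2 q (inord 1) ord_max; - beta1 q ord0 ord_max;
        alpha1 q ord0 ord0; beta2 q ord0 (inord 1);
        beta2 q ord0 (inord 0); - alpha2 q (inord 2) ord_max] i).
Proof.
have mul_delta m (A : 'M[K]_(m, 2)) k j : (A *m delta_mx j ord0 : 'cV_m) k ord0 = A k j.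
  by rewrite -colE mxE.
split; rewrite mxE /F8 eta8E /Fz /Fa /Fb !mul_delta !wedge2E !mxE /= !wedge2E !mxE /=;
  by case: i => -[|[|[|[|[|[|[|[|]]]]]]]] // ? /=; ring.
Qed.

Lemma Fmat_Finv G : Fmat (Finv G) = G.
Proof.
have E (i : 'I_8) j (k : nat) : (i = k :> nat) -> G (inord k) j = G i j.
  by move=> <-; rewrite inord_val.
apply/matrixP => i j.
case: (ord2P j) => ->.
all: rewrite FmatE !mxE /= !inordK //.
all: by case: i E => -[|[|[|[|[|[|[|[|]]]]]]]] // ? E /=;
  rewrite ?opprK; apply: E.
Qed.

Lemma Psi_plane q : Psi q = plane (Fmat q).
Proof.
have E j : col j (Fmat q) = F8 q (delta_mx j ord0) by apply/colP => i; rewrite !mxE.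
by rewrite -wedge8_plane !E.
Qed.

Lemma sum_ord3 (F : 'I_3 -> K) :
  \sum_i F i = F (inord 0) + F (inord 1) + F (inord 2).
Proof.
rewrite !big_ord_recl big_ord0 addr0 addrA.
by congr (F _ + F _ + F _); apply: val_inj; rewrite /= inordK.
Qed.

Lemma sum_ord8 (F : 'I_8 -> K) : \sum_i F i =
  F (inord 0) + F (inord 1) + F (inord 2) + F (inord 3) +
  F (inord 4) + F (inord 5) + F (inord 6) + F (inord 7).
Proof.
rewrite !big_ord_recl big_ord0 addr0 !addrA.
by congr (F _ + F _ + F _ + F _ + F _ + F _ + F _ + F _); apply: val_inj; rewrite /= inordK.
Qed.

Lemma rev_inord k : (k < 8)%N -> rev_ord (inord k : 'I_8) = inord (7 - k).
Proof. by move=> k8; apply: val_inj; rewrite /= !inordK //; lia. Qed.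

(** The right-hand side is [-2 eps m_0] with [m_0] the trace-free part of [m]: multiplication by
    [eps] identifies sl_2 with symmetric matrices. The moment map of SL_2 thus becomes the Gram
    matrix of the pair. *)
Lemma gram_moment q u :
  let m := beta2 u *m alpha2 q + beta2 q *m alpha2 u
           - (alpha1 u *m beta1 q + alpha1 q *m beta1 u) in
  (Fmat q)^T *m J *m Fmat u + (Fmat u)^T *m J *m Fmat q =
  \matrix_(i, j) nth 0 (nth [::]
    [:: [:: - (m ord_max ord0 *+ 2); m ord0 ord0 - m ord_max ord_max];
        [:: m ord0 ord0 - m ord_max ord_max; m ord0 ord_max *+ 2]] i) j.
Proof.
move=> m; rewrite /m => {m}.
by apply: mx22P; rewrite [LHS]mxE !formE !sum_ord8 !rev_inord // !FmatE !inordK //=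
  !mxE /= !sum_ord3 !big_ord1; ring.
Qed.

Lemma omegaV_form q u : omegaV q u = \tr (eps *m (Fmat q)^T *m J *m Fmat u).
Proof.
rewrite -!mulmxA (mulmxA _ J) /mxtrace sum_ord2 !mxE !sum_ord2 !epsE !formE.
rewrite !sum_ord8 !rev_inord // !FmatE !inordK //=.
rewrite /omegaV /mxtrace !big_ord1 !sum_ord2 !mxE !sum_ord2 !sum_ord3.
ring.
Qed.
End QuiverPlanes.

(** * Moment map, injectivity and coordinates in terms of pairs *)

Section QuiverDictionary.
Variable K : numFieldType.
Local Notation J := (J8 K).
Local Notation eps := (eps K).

Lemma is_scalar_mx2P (m : 'M[K]_2) : is_scalar_mx m <->
  [/\ m ord_max ord0 = 0, m ord0 ord_max = 0 & m ord0 ord0 = m ord_max ord_max].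
Proof.
split=> [/is_scalar_mxP[a ->]|[E1 E2 E3]]; first by rewrite !mxE.
by apply/is_scalar_mxP; exists (m ord0 ord0); apply: mx22P; rewrite !mxE //= E3.
Qed.

Lemma tangentNP (q u : cotangentV K) : tangentN q u <-> isotangent (Fmat q) (Fmat u).
Proof.
rewrite /tangentN /isotangent /= gram_moment; move: (_ - _) => m.
have two : (2 : K) != 0 by rewrite pnatr_eq0.
split=> [/is_scalar_mx2P[E1 E2 E3]|E].
  by apply: mx22P; rewrite !mxE /= ?E1 ?E2 ?E3 ?subrr ?mul0rn ?oppr0.
have Eij i j := congr1 (fun M : 'M[K]_2 => M i j) E.
have := (Eij ord0 ord0, Eij ord_max ord_max, Eij ord0 ord_max).
rewrite !mxE /= => -[[/eqP E1 /eqP E2] /eqP E3]; apply/is_scalar_mx2P.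
move: E1 E2 E3; rewrite oppr_eq0 !mulrn_eq0 /= subr_eq0.
by move=> /eqP -> /eqP -> /eqP ->.
Qed.

Lemma isotangent_self (G : 'M[K]_(8, 2)) : isotangent G G <-> isotropic G.
Proof.
rewrite /isotangent /isotropic -mulr2n -scaler_nat; split=> [|->].
  by move/eqP; rewrite scaler_eq0 pnatr_eq0 /= => /eqP.
by rewrite scaler0.
Qed.

(** The moment map is quadratic, so its polarisation at [u = q] is twice its value and [tangentNP]
    applies. *)
Lemma NP (q : cotangentV K) : N q <-> isotropic (Fmat q).
Proof.
rewrite -isotangent_self -tangentNP /N /tangentN /=.
set a := beta2 q *m _; set b := alpha1 q *m _.
have -> : a + a - (b + b) = 2 *: (a - b) by rewrite scaler_nat mulr2n opprD addrACA.
have two : (2 : K) != 0 by rewrite pnatr_eq0.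
split=> /is_scalar_mxP[c E]; apply/is_scalar_mxP.
  by exists (2 * c); rewrite E scale_scalar_mx.
exists (2^-1 * c); rewrite -scale_scalar_mx -E scalerA mulVf // scale1r.
by [].
Qed.

Lemma Ninj_good (G : 'M[K]_(8, 2)) : isotropic G -> good G -> Ninj (Finv G).
Proof.
move=> G0 [m12 [l Gl]]; split; first by apply/NP; rewrite Fmat_Finv.
  move=> v w /matrixP E; apply/matrixP => i j; rewrite !ord1.
  have := (E ord0 ord0, E ord_max ord0); rewrite !mxE !big_ord1 !mxE /= => -[E1 E2].
  have [l0|l1] := ord2P l.
    by move: Gl E2; rewrite l0 -oppr_eq0 => Gl; apply: mulfI.
  by move: Gl E1; rewrite l1 => Gl; apply: mulfI.
move=> v w E.
have u : rows2 K (inord 1) (inord 2) *m G \in unitmx.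
  by rewrite unitmxE unitfE det_rows2.
suff E' : rows2 K (inord 1) (inord 2) *m G *m v = rows2 K (inord 1) (inord 2) *m G *m w.
  by rewrite -[v](mulKmx u) E' mulKmx.
rewrite mul_rowsub_mx mul1mx; apply/colP => i; rewrite !mxE.
case: (ord2P i) => ->.
  have /colP/(_ (inord 0)) := E; rewrite !mxE => E0.
  transitivity (\sum_j (alpha2 (Finv G)) (inord 0) j * v j ord0).
    by apply: eq_bigr => j _; rewrite !mxE /= inordK.
  by rewrite E0; apply: eq_bigr => j _; rewrite !mxE /= inordK.
have /colP/(_ (inord 1)) := E; rewrite !mxE => E0.
transitivity (\sum_j (alpha2 (Finv G)) (inord 1) j * v j ord0).
  by apply: eq_bigr => j _; rewrite !mxE /= inordK.
by rewrite E0; apply: eq_bigr => j _; rewrite !mxE /= inordK.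
Qed.

Definition cvec (G : 'M[K]_(8, 2)) : 'rV[K]_dimTV := coords (Finv G).

Lemma cvec_linear a G U : cvec (a *: G + U) = a *: cvec G + cvec U.
Proof.
rewrite /cvec /coords !(scale_row_mx, add_row_mx) -!linearP /=.
congr (row_mx (mxvec _) (row_mx (mxvec _) (row_mx (mxvec _) (mxvec _)))).
- apply/matrixP => i j; rewrite !mxE.
  by case: i => -[|[|]] // ? /=; ring.
- apply/matrixP => i j; rewrite !mxE.
  by case: i => -[|[|[|]]] // ? /=; ring.
- apply/matrixP => i j; rewrite !mxE; ring.
- apply/matrixP => i j; rewrite !mxE.
  by case: i j => -[|[|]] // ? [[|[|[|]]] ?] //=; ring.
Qed.

End QuiverDictionary.

(** * Tangent spaces and dimension *)

Section Tangents.
Variable K : numFieldType.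

Lemma linear_form_sum m (l : 'rV[K]_m -> K) :
  (forall a u v, l (a *: u + v) = a * l u + l v) ->
  forall x, l x = \sum_i x ord0 i * l (delta_mx ord0 i).
Proof.
move=> lP x; have l0 : l 0 = 0.
  by have := lP (-1) 0 0; rewrite scaler0 addr0 mulN1r addNr.
rewrite [x in LHS]row_sum_delta; elim/big_rec2: _ => // i y z _ <-.
by rewrite lP.
Qed.

(** Expanding [b] on the standard basis makes [b y y] a polynomial vanishing on [S]; its derivative
    is the polarisation. *)
Lemma quadratic_tangent m (S : set 'rV[K]_m) (b : 'rV[K]_m -> 'rV[K]_m -> K) :
  (forall a u v w, b (a *: u + v) w = a * b u w + b v w) ->
  (forall a u v w, b w (a *: u + v) = a * b w u + b w v) ->
  (forall x, S x -> b x x = 0) ->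
  forall x u, tangent S x u -> b x u + b u x = 0.
Proof.
move=> bl br bS x u Tu.
pose p : mpoly m K := \sum_i \sum_j
  mpolyC m (b (delta_mx ord0 i) (delta_mx ord0 j)) *
  (mpolyX K (mnm1 i) * mpolyX K (mnm1 j)).
have evp y : evalp p y = b y y.
  rewrite (linear_form_sum (fun a u v => bl a u v y)) /evalp raddf_sum.
  apply: eq_bigr => i _; rewrite (linear_form_sum (fun a u v => br a u v _)).
  rewrite raddf_sum mulr_sumr; apply: eq_bigr => j _.
  by apply: (etrans (evalpM _ _ y)); rewrite evalpC evalpM !evalpX; ring.
have := Tu p; rewrite (@diffp_line _ _ p x u
  ((b x x)%:P + (b x u + b u x) *: 'X + b u u *: 'X^2)).
  rewrite !coefD !coefZ coefC coefX coefXn /= mulr1 mulr0 add0r addr0; apply.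
  by move=> y Sy; rewrite evp bS.
move=> s; rewrite evp [x + _]addrC bl !br !hornerE /=; ring.
Qed.

(** The components of [g] after [f] minus the coordinates vanish on [X], hence their differentials
    vanish on tangent vectors. *)
Lemma diffmap_inverse m n (X : set 'rV[K]_m) (f : 'I_n -> mpoly m K)
    (g : 'I_m -> mpoly n K) x u :
  (forall y, X y -> evalmap g (evalmap f y) = y) -> tangent X x u ->
  diffmap g (evalmap f x) (diffmap f x u) = u.
Proof.
move=> gf Tu; apply/rowP => i; rewrite mxE -diffp_comp.
have /eqP : diffp (comp_map (g i) f - mpolyX K (mnm1 i)) x u = 0.
  apply: Tu => y Xy.
  by rewrite evalpB evalp_comp evalpX -[in X in _ - X](gf _ Xy) mxE subrr.
by rewrite diffpB diffpX subr_eq0 => /eqP.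
Qed.

Lemma tangent_map m n (X : set 'rV[K]_m) (Y : set 'rV[K]_n)
    (f : 'I_n -> mpoly m K) x u :
  (forall y, X y -> Y (evalmap f y)) -> tangent X x u ->
  tangent Y (evalmap f x) (diffmap f x u).
Proof.
move=> XY Tu p pY; rewrite -diffp_comp; apply: Tu => y /XY/pY.
by rewrite evalp_comp.
Qed.

(* The tangent vectors to the cone over the isotropic Grassmannian are cut out
   by the Pluecker relations and the equation [M ^+ 2 = 0]. *)
Lemma tangent_planes (Y : set 'rV[K]_(8 * 8)) (G : 'M[K]_(8, 2)) B :
  (forall y, Y y -> exists2 G, isotropic G & y = mxvec (plane G)) ->
  isotropic G -> plane G != 0 -> tangent Y (mxvec (plane G)) B ->
  exists2 U, isotangent G U & vec_mx B = dplane G U.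
Proof.
move=> YG G0 Gn TB; have [H HG] := left_inverse_plane Gn.
have quad (b : 'M[K]_8 -> 'M[K]_8 -> 'M[K]_8) :
    (forall a u v w, b (a *: u + v) w = a *: b u w + b v w) ->
    (forall a u v w, b w (a *: u + v) = a *: b w u + b w v) ->
    (forall G, isotropic G -> b (plane G) (plane G) = 0) ->
    b (plane G) (vec_mx B) + b (vec_mx B) (plane G) = 0.
  move=> bl br bG; apply/matrixP => i j; rewrite !mxE.
  have := @quadratic_tangent _ Y (fun y z => b (vec_mx y) (vec_mx z) i j) _ _ _ _ _ TB.
  rewrite mxvecK; apply.
  - by move=> a u v w; rewrite linearP bl !mxE.
  - by move=> a u v w; rewrite linearP br !mxE.
  - by move=> y /YG[G' G'0 ->]; rewrite mxvecK bG // mxE.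
have [U BU] : exists U, vec_mx B = dplane G U.
  apply: (@plucker_tangent _ G H) => //; set X := H^T.
  pose b (M M' : 'M[K]_8) := (X^T *m (M *m J8 K) *m X) ord0 ord_max *: (M' *m J8 K)
    - M *m J8 K *m X *m eps K *m X^T *m (M' *m J8 K)^T.
  have := quad b; rewrite /b => /(_ _ _ _)/eqP => E.
  have {}E := E _ _ _; move: E; rewrite addrACA -opprD subr_eq0 => E.
  rewrite addrC (eqP (E _ _ _)) 1?addrC //.
  - move=> a u v w; rewrite !(mulmxDl, mulmxDr) -!(scalemxAl, scalemxAr).
    by rewrite !mxE scalerDl scalerBr opprD -scalerA addrACA.
  - move=> a u v w; have -> : ((a *: u + v) *m J8 K)^T = a *: (u *m J8 K)^T + (v *m J8 K)^T.
      by rewrite mulmxDl -scalemxAl linearD linearZ.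
    rewrite mulmxDl -scalemxAl mulmxDr -scalemxAr !scalerDr scalerN.
    by rewrite !scalerA mulrC opprD addrACA.
  - by move=> G' _; rewrite plucker subrr.
exists U => //; apply: (isotangent_sq HG G0); rewrite -BU.
apply: (quad (fun M M' => M *m M')).
- by move=> a u v w; rewrite mulmxDl -scalemxAl.
- by move=> a u v w; rewrite mulmxDr -scalemxAr.
- by move=> G' G'0; rewrite plane_sq.
Qed.

End Tangents.

(** * An affine chart of the cone *)

Section Chart.
Variable K : numFieldType.
Local Notation ix k := (inord k : 'I_10).
Local Notation "'z_ k" := (mpolyX K (mnm1 (ix k))) (at level 8, k at level 2, format "''z_' k").

(* The affine chart of the isotropic Grassmannian where rows 1 and 2 form the
   identity matrix; the first variable scales the first column, so that [plane]
   of the result ranges over the corresponding open subset of the cone. *)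
Definition chart_mpoly (i : 'I_8) (j : 'I_2) : mpoly 10 K :=
  if j == ord0 then
    'z_0 * nth 0 [:: 'z_1; 1; 0; 'z_2; 'z_3; 'z_5; - ('z_1 * 'z_4 + 'z_2 * 'z_3); 'z_4] i
  else
    nth 0 [:: 'z_6; 0; 1; 'z_7; 'z_8; - ('z_6 * 'z_9 + 'z_7 * 'z_8);
      - ('z_5 + 'z_1 * 'z_9 + 'z_4 * 'z_6 + 'z_2 * 'z_8 + 'z_3 * 'z_7); 'z_9] i.

Definition chart (z : 'rV[K]_10) : 'M[K]_(8, 2) :=
  \matrix_(i, j) evalp (chart_mpoly i j) z.

Lemma evalpN n (p : mpoly n K) x : evalp (- p) x = - evalp p x.
Proof. exact: mevalN. Qed.
Lemma evalp0 n (x : 'rV[K]_n) : evalp 0 x = 0.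
Proof. exact: meval0. Qed.
Lemma evalp1 n (x : 'rV[K]_n) : evalp 1 x = 1.
Proof. exact: meval1. Qed.

Definition evalpE := (evalpD, evalpN, evalpM, evalpX, evalp0, evalp1).

Lemma chartE (z : 'rV[K]_10) (c := fun k => z ord0 (ix k)) (i : 'I_8) :
  (chart z i ord0 = c 0%N * nth 0
    [:: c 1%N; 1; 0; c 2%N; c 3%N; c 5%N; - (c 1%N * c 4%N + c 2%N * c 3%N); c 4%N] i) *
  (chart z i ord_max = nth 0 [:: c 6%N; 0; 1; c 7%N; c 8%N; - (c 6%N * c 9%N + c 7%N * c 8%N);
      - (c 5%N + c 1%N * c 9%N + c 4%N * c 6%N + c 2%N * c 8%N + c 3%N * c 7%N); c 9%N] i).
Proof.
split; rewrite mxE /chart_mpoly /=;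
by case: i => -[|[|[|[|[|[|[|[|]]]]]]]] // ?; rewrite /= !evalpE.
Qed.

Lemma isotropic_chart z : isotropic (chart z).
Proof.
by apply: mx22P; rewrite formE sum_ord8 !rev_inord // !chartE !inordK //= mxE; ring.
Qed.

Lemma chart_surj (G : 'M[K]_(8, 2)) : isotropic G ->
  minor2 G (inord 1) (inord 2) != 0 -> exists z, plane G = plane (chart z).
Proof.
move=> G0 m12; pose D := rows2 K (inord 1) (inord 2) *m G.
have Du : D \in unitmx by rewrite unitmxE unitfE det_rows2.
pose G1 := G *m invmx D.
have G10 : isotropic G1 by exact: isotropic_col.
have D1 : rows2 K (inord 1) (inord 2) *m G1 = 1%:M.
  by rewrite /G1 mulmxA mulmxV.
have -> : plane G = \det D *: plane G1 by rewrite -plane_col /G1 mulmxKV.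
clearbody G1.
(* A diagonal matrix of determinant [\det D] moves the scalar into the first column, where the chart
   puts its scaling variable. *)
pose a : 'M[K]_2 := \matrix_(i, j) if i == j then if i == ord0 then \det D else 1 else 0.
have da : \det a = \det D by rewrite det22 !mxE /=; ring.
rewrite -da -plane_col.
have R i j : G1 (inord (if i == ord0 :> 'I_2 then 1 else 2)) j = (i == j)%:R.
  have /matrixP/(_ i j) := D1; rewrite mul_rowsub_mx mul1mx !mxE => <-.
  by case: ifP.
have R10 := R ord0 ord0; have R11 := R ord0 ord_max.
have R20 := R ord_max ord0; have R21 := R ord_max ord_max.
rewrite /= in R10 R11 R20 R21.
have F i j : (G1^T *m J8 K *m G1) i j = 0 by rewrite G10 mxE.
have := (F ord0 ord0, F ord_max ord_max, F ord0 ord_max).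
rewrite !formE !sum_ord8 !rev_inord //= R10 R11 R20 R21 => -[[F0 F1] F01].
have two : (2 : K) != 0 by rewrite pnatr_eq0.
exists (\row_i nth 0 [:: \det D; G1 (inord 0) ord0; G1 (inord 3) ord0;
  G1 (inord 4) ord0; G1 (inord 7) ord0; G1 (inord 5) ord0; G1 (inord 0) ord_max;
  G1 (inord 3) ord_max; G1 (inord 4) ord_max; G1 (inord 7) ord_max] i).
congr plane; apply/matrixP => i j.
have [k k8 ->] : exists2 k, (k < 8)%N & i = inord k by exists i; rewrite ?inord_val.
(* The three isotropy equations are solved for the three entries that are not free coordinates of
   the chart. *)
have E6 : G1 (inord 6) ord0 = - (G1 (inord 0) ord0 * G1 (inord 7) ord0 +
    G1 (inord 3) ord0 * G1 (inord 4) ord0).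
  by apply: (mulfI two); apply/eqP; rewrite -subr_eq0 -F0; apply/eqP; ring.
have E5 : G1 (inord 5) ord_max = - (G1 (inord 0) ord_max * G1 (inord 7) ord_max +
    G1 (inord 3) ord_max * G1 (inord 4) ord_max).
  by apply: (mulfI two); apply/eqP; rewrite -subr_eq0 -F1; apply/eqP; ring.
have E61 : G1 (inord 6) ord_max = - (G1 (inord 5) ord0 +
    G1 (inord 0) ord0 * G1 (inord 7) ord_max + G1 (inord 7) ord0 * G1 (inord 0) ord_max
    + G1 (inord 3) ord0 * G1 (inord 4) ord_max + G1 (inord 4) ord0 * G1 (inord 3) ord_max).
  by apply/eqP; rewrite -subr_eq0 -F01; apply/eqP; ring.
rewrite [LHS]mxE sum_ord2 [a ord0 _]mxE [a ord_max _]mxE.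
case: (ord2P j) => ->.
all: rewrite chartE !mxE !inordK //=.
all: case: k k8 => [|[|[|[|[|[|[|[|]]]]]]]] // _ /=; rewrite ?R10 ?R11 ?R20 ?R21 ?E6 ?E5 ?E61; ring.
Qed.
End Chart.

(** * Linear coordinates on the cone and its tangent space at a base point *)

Section Dimension.
Variable K : numFieldType.
Local Notation eps := (eps K).
Local Notation J := (J8 K).

Lemma cvec_sum (G : 'M[K]_(8, 2)) :
  cvec G = \sum_i \sum_j G i j *: cvec (delta_mx i j).
Proof.
have c0 : cvec (0 : 'M[K]_(8, 2)) = 0.
  by have := cvec_linear (-1) (0 : 'M[K]_(8, 2)) 0; rewrite scaler0 addr0 scaleN1r addNr.
have cD (A B : 'M[K]_(8, 2)) : cvec (A + B) = cvec A + cvec B.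
  by rewrite -[A]scale1r cvec_linear !scale1r.
rewrite [in LHS](matrix_sum_delta G).
rewrite (big_morph _ cD c0); apply: eq_bigr => i _.
rewrite (big_morph _ cD c0); apply: eq_bigr => j _.
by rewrite -[_ *: delta_mx i j]addr0 cvec_linear c0 addr0.
Qed.

Definition chart_cvec (k : 'I_dimTV) : mpoly 10 K := \sum_i \sum_j
  chart_mpoly K i j * mpolyC 10 (cvec (delta_mx i j : 'M[K]_(8, 2)) ord0 k).

Lemma evalmap_chart_cvec z : evalmap chart_cvec z = cvec (chart z).
Proof.
apply/rowP => k; rewrite mxE cvec_sum summxE /evalp raddf_sum /=; apply: eq_bigr => i _.
rewrite summxE raddf_sum /=; apply: eq_bigr => j _.
by apply: (etrans (evalpM _ _ z)); rewrite evalpC !mxE.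
Qed.

(* Coordinates [(i, j)] of the bivector that restrict to [t z_1, ..., t z_9]
   and to the scaling [t] on the chart. *)
Definition kap_idx (k : nat) : nat * nat := nth (0, 0)%N
  [:: (1, 2); (0, 2); (3, 2); (4, 2); (7, 2); (5, 2); (1, 0); (1, 3); (1, 4); (1, 7)]%N k.

Definition kap (M : 'M[K]_8) : 'rV[K]_10 :=
  \row_k - (M *m J) (inord (kap_idx k).1) (inord (kap_idx k).2).

Lemma kap_linear a A B : kap (a *: A + B) = a *: kap A + kap B.
Proof.
apply/rowP => k; rewrite [LHS]mxE mulmxDl -scalemxAl.
by rewrite !mxE opprD mulrN.
Qed.

Lemma ord10P (P : 'I_10 -> Prop) :
  (forall k (k10 : (k < 10)%N), P (inord k)) -> forall i, P i.
Proof. by move=> H i; rewrite -(inord_val i); apply: H. Qed.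

Lemma kap_chart (z : 'rV[K]_10) k : kap (plane (chart z)) ord0 k =
  z ord0 ord0 * if k == ord0 then 1 else z ord0 k.
Proof.
have -> : ord0 = inord 0 :> 'I_10 by apply: val_inj; rewrite /= inordK.
elim/ord10P: k => k k10; rewrite mxE planeJ opprK.
have -> : (inord k == inord 0 :> 'I_10) = (k == 0)%N.
  by rewrite -val_eqE /= !inordK.
rewrite /minor2 !chartE (inordK k10).
by case: k k10 => [|[|[|[|[|[|[|[|[|[|]]]]]]]]]] // _; rewrite /= !inordK //=; ring.
Qed.

Definition Gbase : 'M[K]_(8, 2) := chart (delta_mx ord0 ord0).

Lemma GbaseE i : (Gbase i ord0 = (i == inord 1)%:R) * (Gbase i ord_max = (i == inord 2)%:R).
Proof.
rewrite /Gbase !chartE !mxE -!val_eqE /= !inordK //=.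
by case: i => -[|[|[|[|[|[|[|[|]]]]]]]] // ? /=; split; ring.
Qed.

Lemma isotropic_Gbase : isotropic Gbase.
Proof. exact: isotropic_chart. Qed.

Lemma plane_Gbase : plane Gbase != 0.
Proof.
apply/eqP => E; have := planeJ Gbase (inord 1) (inord 2).
rewrite E mul0mx mxE => /eqP; rewrite eq_sym oppr_eq0; apply/negP.
by rewrite /minor2 !GbaseE -!val_eqE /= !inordK //= !mulr1 mulr0 subr0 oner_eq0.
Qed.

(** This is the derivative of [chart] at the point defining [Gbase]. It complements the trace-free
    column operations, which [dplane] kills. *)
Definition lam (z : 'rV[K]_10) : 'M[K]_(8, 2) :=
  let c k := z ord0 (inord k) in \matrix_(i, j)
  if j == ord0 then nth 0 [:: c 1%N; c 0%N; 0; c 2%N; c 3%N; c 5%N; 0; c 4%N] i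
  else nth 0 [:: c 6%N; 0; 0; c 7%N; c 8%N; 0; - c 5%N; c 9%N] i.

Lemma lam_linear a u v : lam (a *: u + v) = a *: lam u + lam v.
Proof.
apply/matrixP => i j; rewrite !mxE.
by case: ifP => _; case: i => -[|[|[|[|[|[|[|[|]]]]]]]] // ? /=; rewrite ?mxE; ring.
Qed.

Lemma isotangent_lam z : isotangent Gbase (lam z).
Proof.
by apply: mx22P; rewrite [LHS]mxE !formE !sum_ord8 !rev_inord // !GbaseE !mxE
  -!val_eqE /= !inordK //=; ring.
Qed.

Lemma dplaneJ (G U : 'M[K]_(8, 2)) i j : (dplane G U *m J) i j =
  - (G i ord0 * U j ord_max - G i ord_max * U j ord0
     + U i ord0 * G j ord_max - U i ord_max * G j ord0).
Proof.
rewrite dplaneJE !mxE !sum_ord2 !mxE !sum_ord2 !epsE; ring.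
Qed.

Lemma kap_lam z : kap (dplane Gbase (lam z)) = z.
Proof.
apply/rowP; elim/ord10P => k k10; rewrite mxE dplaneJ opprK (inordK k10).
rewrite !GbaseE !mxE -!val_eqE.
by case: k k10 => [|[|[|[|[|[|[|[|[|[|]]]]]]]]]] // _; rewrite /= !inordK //=; ring.
Qed.

Lemma dplane_col (G : 'M[K]_(8, 2)) a : dplane G (G *m a) = \tr a *: plane G.
Proof.
rewrite /dplane /plane trmx_mul scalerN; congr (- _).
rewrite !mulmxA -2!mulmxDl 2!scalemxAl; congr (_ *m _ *m _).
rewrite -!mulmxA -mulmxDr scalemxAr; congr (_ *m _).
by apply: mx22P; rewrite /mxtrace sum_ord2 !mxE !sum_ord2 !mxE !epsE; ring.
Qed.

(** The ten coordinates and the three isotropy equations force [U = Gbase a] with [a] of trace 0,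
    where [a] consists of rows 1 and 2 of [U], the rows in which [Gbase] is the identity. Such
    directions do not change the bivector. *)
Lemma kap_inj U : isotangent Gbase U -> kap (dplane Gbase U) = 0 ->
  dplane Gbase U = 0.
Proof.
move=> TU k0; pose a : 'M[K]_2 := \matrix_(i, j) U (inord i.+1) j.
have kE k : (k < 10)%N -> kap (dplane Gbase U) ord0 (inord k) = 0.
  by rewrite k0 mxE.
have E k (k10 : (k < 10)%N) := kE k k10; move: E.
have {}kE k : (k < 10)%N -> let p := kap_idx k in
    Gbase (inord p.1) ord0 * U (inord p.2) ord_max
    - Gbase (inord p.1) ord_max * U (inord p.2) ord0
    + U (inord p.1) ord0 * Gbase (inord p.2) ord_max
    - U (inord p.1) ord_max * Gbase (inord p.2) ord0 = 0.
  by move=> k10; have := kE k k10; rewrite mxE dplaneJ opprK (inordK k10).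
move=> _; have F i j : (Gbase^T *m J *m U) i j + (U^T *m J *m Gbase) i j = 0.
  by have /matrixP/(_ i j) := TU; rewrite mxE [RHS]mxE.
have two : (2 : K) != 0 by rewrite pnatr_eq0.
have := (F ord0 ord0, F ord_max ord_max, F ord0 ord_max).
rewrite !formE.
rewrite !sum_ord8 !rev_inord // !GbaseE -!val_eqE /= !inordK //=.
rewrite !(subSS, subn0) !(mul0r, mulr0, mul1r, mulr1, add0r, addr0) => -[[F0 F1] F01].
have := (kE 0%N isT, kE 1%N isT, kE 2%N isT, kE 3%N isT, kE 4%N isT,
  kE 5%N isT, kE 6%N isT, kE 7%N isT, kE 8%N isT, kE 9%N isT) => {kE}.
rewrite /= !GbaseE -!val_eqE /= !inordK //=.
rewrite !(mul0r, mulr0, mul1r, mulr1, subr0, add0r, addr0).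
move=> [[[[[[[[[E0 E1] E2] E3] E4] E5] E6] E7] E8] E9].
have tra : \tr a = 0 by rewrite /mxtrace sum_ord2 !mxE /= -E0 addrC.
have {}F0 : U (inord 6) ord0 = 0 by apply: (mulfI two); rewrite mulr0 -F0; ring.
have {}F1 : U (inord 5) ord_max = 0 by apply: (mulfI two); rewrite mulr0 -F1; ring.
rewrite E5 addr0 in F01.
suff -> : U = Gbase *m a by rewrite dplane_col tra scale0r.
apply/matrixP => i j; rewrite [RHS]mxE sum_ord2 !GbaseE [a ord0 j]mxE [a ord_max j]mxE.
have [k k8 ->] : exists2 k, (k < 8)%N & i = inord k by exists i; rewrite ?inord_val.
rewrite -!val_eqE /= !inordK //.
case: (ord2P j) => ->.
all: by case: k k8 => [|[|[|[|[|[|[|[|]]]]]]]] // _ /=;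
  rewrite ?(mul0r, mul1r, addr0, add0r, E1, E2, E3, E4, E5, E6, E7, E8, E9, F0, F1, F01).
Qed.

End Dimension.

(** * The quotient variety: points, tangent spaces, dimension and smooth locus *)

Section Quotient.
Variables (K : numFieldType) (n : nat) (f : 'I_n -> mpoly dimTV K).
Variables (Omin : set 'M[K]_8) (phi : 'I_(8 * 8) -> mpoly n K).
Local Notation X := (quotientN f).
Local Notation Y := (mxvec @` (Omin `|` [set 0]) : set 'rV[K]_(8 * 8)).
Hypothesis Omin_orbit : exists2 M, M != 0 & Omin = orbit8 M.
Hypothesis phi_iso : is_isomorphism X Y phi.
Hypothesis phi_Psi : forall q, N q ->
  evalmap phi (evalmap f (coords q)) = mxvec (Psi q).

Definition fG (G : 'M[K]_(8, 2)) : 'rV[K]_n := evalmap f (cvec G).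
Definition dfG (G U : 'M[K]_(8, 2)) : 'rV[K]_n := diffmap f (cvec G) (cvec U).

Lemma NFinv (G : 'M[K]_(8, 2)) : isotropic G -> N (Finv G).
Proof. by move=> G0; apply/NP; rewrite Fmat_Finv. Qed.

Lemma phi_fG G : isotropic G -> evalmap phi (fG G) = mxvec (plane G).
Proof. by move=> /NFinv/phi_Psi; rewrite Psi_plane Fmat_Finv. Qed.

Lemma fG_quotient G : isotropic G -> X (fG G).
Proof. by move=> G0 p pv; apply: pv; exists (Finv G) => //; apply: NFinv. Qed.

Lemma plane_closure G : isotropic G -> Omin (plane G) \/ plane G = 0.
Proof.
case: phi_iso => g [XY _ _ _] G0; have := XY _ (fG_quotient G0).
by rewrite phi_fG // => -[M MO /(can_inj mxvecK) <-].
Qed.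

Lemma SO8_inv (g : 'M[K]_8) : SO8 g -> SO8 (invmx g).
Proof.
move=> Sg; have gu := SO8_unit Sg; split; last by rewrite det_inv (proj2 Sg) invr1.
have /(congr1 (fun M => (invmx g)^T *m M *m invmx g)) := proj1 Sg.
by rewrite -!mulmxA mulmxV // mulmx1 (mulmxA _ g^T) -trmx_mul mulmxV // trmx1 mul1mx mulmxA => /esym.
Qed.

Lemma SO8_mul (g h : 'M[K]_8) : SO8 g -> SO8 h -> SO8 (g *m h).
Proof.
move=> [gJ g1] [hJ h1]; split; last by rewrite det_mulmx g1 h1 mulr1.
by rewrite trmx_mul -!mulmxA (mulmxA g^T) (mulmxA _ g) gJ mulmxA.
Qed.

Lemma plane_orbit_neq0 (g : 'M[K]_8) G :
  SO8 g -> plane G != 0 -> plane (g *m G) != 0.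
Proof.
move=> Sg; apply: contra_neq; rewrite plane_orbit // => E.
have gu := SO8_unit Sg.
by rewrite -[plane G](mulKmx gu) -[g *m _](mulmxKV gu) E mul0mx mulmx0.
Qed.

Lemma isotropic_witness : exists G : 'M[K]_(8, 2), isotropic G /\ plane G != 0.
Proof.
exists (Gstar K); split; first exact: isotropic_Gstar.
apply/eqP => E; have := planeJ (Gstar K) (inord 1) (inord 2).
rewrite E mul0mx mxE => /eqP; rewrite eq_sym oppr_eq0; apply/negP.
by apply: minor2_Gstar; rewrite -?val_eqE /= !inordK.
Qed.


Lemma orbit_plane G M : isotropic G -> plane G != 0 -> Omin M ->
  exists2 g, SO8 g & M = plane (g *m G).
Proof.
move=> G0 Gn; have := plane_closure G0; case: Omin_orbit => M0 M0n ->.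
case=> [[h hS hM]|E]; last by rewrite E eqxx in Gn.
case=> g gS <-; exists (g *m invmx h); first exact/SO8_mul/SO8_inv.
have hu := SO8_unit hS; have gu := SO8_unit gS.
rewrite -(mulmxA g _ G) plane_orbit // plane_orbit; last exact: SO8_inv.
rewrite invmxK -hM.
by rewrite [invmx h *m _]mulmxA [invmx h *m _]mulmxA mulVmx // mul1mx mulmxKV.
Qed.

(** The isomorphism puts every nonzero [plane G] into [Omin]. Conversely, one such point reaches the
    whole orbit, conjugation by [g] acting on pairs as left multiplication. *)
Lemma Omin_plane M :
  Omin M <-> exists G, [/\ isotropic G, plane G != 0 & M = plane G].
Proof.
split=> [OM|[G [G0 Gn ->]]]; last first.
  by case: (plane_closure G0) => // E; rewrite E eqxx in Gn.
have [G [G0 Gn]] := isotropic_witness; have [g Sg ->] := orbit_plane G0 Gn OM.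
exists (g *m G); split=> //; first exact: isotropic_orbit.
exact: plane_orbit_neq0.
Qed.

Lemma isotropic0 : isotropic (0 : 'M[K]_(8, 2)).
Proof. by rewrite /isotropic mulmx0. Qed.

Lemma plane0 : plane (0 : 'M[K]_(8, 2)) = 0.
Proof. by rewrite /plane !mul0mx oppr0. Qed.

Lemma closure_plane y : Y y -> exists2 G, isotropic G & y = mxvec (plane G).
Proof.
move=> [M [OM|->] <-]; last by exists 0; [exact: isotropic0|rewrite plane0].
by have /Omin_plane[G [G0 _ ->]] := OM; exists G.
Qed.

Lemma fG_inj G G' : isotropic G -> isotropic G' -> plane G = plane G' ->
  fG G = fG G'.
Proof.
case: phi_iso => g [_ _ gphi _] G0 G'0 E.
by rewrite -(gphi _ (fG_quotient G0)) -(gphi _ (fG_quotient G'0)) !phi_fG // E.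
Qed.

Lemma quotient_fG x : X x -> exists2 G, isotropic G & x = fG G.
Proof.
case: phi_iso => g [XY _ gphi _] Xx; have [G G0 E] := closure_plane (XY _ Xx).
exists G => //; rewrite -(gphi _ Xx) E -phi_fG //.
exact/gphi/fG_quotient.
Qed.

Lemma cvec_line (G U : 'M[K]_(8, 2)) s : cvec G + s *: cvec U = cvec (G + s *: U).
Proof. by rewrite addrC -cvec_linear addrC. Qed.

Lemma dfG_linear G a U V : dfG G (a *: U + V) = a *: dfG G U + dfG G V.
Proof. by rewrite /dfG cvec_linear diffmap_linear. Qed.

(** [phi_fG] is available on isotropic pairs only, so derivatives are taken along lines of isotropic
    pairs, by comparing linear coefficients in [s]. *)
Lemma dfG_line G U : (forall s, isotropic (G + s *: U)) ->
  tangent X (fG G) (dfG G U) /\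
  diffmap phi (fG G) (dfG G U) = mxvec (dplane G U).
Proof.
move=> GU; split=> [p pv|].
  rewrite /dfG /fG -diffp_comp (@diffp_line _ _ _ _ _ 0) ?coef0 // => s.
  by rewrite evalp_comp cvec_line pv ?horner0 //; apply: fG_quotient.
apply/rowP => i; rewrite mxE /dfG /fG -diffp_comp.
rewrite (@diffp_line _ _ _ _ _ ((mxvec (plane G) ord0 i)%:P
  + mxvec (dplane G U) ord0 i *: 'X + mxvec (plane U) ord0 i *: 'X^2)).
  by rewrite !coefD !coefZ coefC coefX coefXn /= mulr1 mulr0 add0r addr0.
move=> s; rewrite evalp_comp cvec_line.
have -> : evalp (phi i) (fG (G + s *: U)) = evalmap phi (fG (G + s *: U)) ord0 i.
  by rewrite mxE.
rewrite phi_fG // planeD_scale !linearD !linearZ /=.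
move: (mxvec _) (mxvec _) (mxvec _) => a b c.
by rewrite !mxE !hornerE /= expr2; ring.
Qed.

(* A tangent vector at [G] is [A G] for some [A] in so_8, which is spanned by the
   [plane G']; the line [G + s plane G' G] consists of isotropic planes. *)
Lemma dfG_tangent G U : isotropic G -> plane G != 0 -> isotangent G U ->
  tangent X (fG G) (dfG G U) /\
  diffmap phi (fG G) (dfG G U) = mxvec (dplane G U).
Proof.
move=> G0 Gn TU; have [H HG] := left_inverse_plane Gn.
have [A A0 <-] := isotangent_witt HG TU.
move: A A0; apply: so8_isotropic_ind => [a A B [TA dA] [TB dB]|G' G'0].
  rewrite mulmxDl -scalemxAl dfG_linear dplane_linear; split.
    by move=> p pv; rewrite diffp_linear TA // TB // mulr0 addr0.
  by rewrite diffmap_linear dA dB linearP.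
by apply: dfG_line => s; apply: isotropic_transvection.
Qed.

Lemma diffmap_phi_inj x u v : X x -> tangent X x u -> tangent X x v ->
  diffmap phi x u = diffmap phi x v -> u = v.
Proof.
case: phi_iso => g [_ _ gphi _] Xx Tu Tv E.
by rewrite -(diffmap_inverse gphi Tu) E (diffmap_inverse gphi Tv).
Qed.

(** A tangent vector is sent by the differential of [phi] to the cone, where [tangent_planes]
    describes it; that differential is injective on tangent vectors. *)
Lemma tangent_fG G w : isotropic G -> plane G != 0 ->
  tangent X (fG G) w <-> exists2 U, isotangent G U & w = dfG G U.
Proof.
move=> G0 Gn; split=> [Tw|[U TU ->]]; last by have [] := dfG_tangent G0 Gn TU.
case: (phi_iso) => g [XY _ _ _].
have := tangent_map XY Tw; rewrite phi_fG // => TY.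
have [U TU E] := tangent_planes closure_plane G0 Gn TY.
exists U => //; have [TU' dU] := dfG_tangent G0 Gn TU.
apply: (diffmap_phi_inj (fG_quotient G0) Tw TU').
by rewrite dU -E vec_mxK.
Qed.

(** Along the line, [p] becomes a polynomial in [s] that vanishes off the roots of [D], hence also
    at [s = 0]. *)
Lemma evalp_line_closed (p : mpoly n K) (G U : 'M[K]_(8, 2)) (D : {poly K}) :
  D != 0 -> (forall s, D.[s] != 0 -> evalp p (fG (G + s *: U)) = 0) ->
  evalp p (fG G) = 0.
Proof.
move=> D0 E; pose q := comp_map p f.
pose g i : {poly K} := (cvec G ord0 i)%:P + cvec U ord0 i *: 'X.
have gE s : (evalp_curve q g).[s] = evalp p (fG (G + s *: U)).
  rewrite evalp_curve_horner evalp_comp /fG -cvec_line; congr (evalp _ (evalmap _ _)).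
  move: (cvec G) (cvec U) @g => a b; apply/rowP => i; rewrite !mxE !hornerE.
  by rewrite mulrC.
have := gE 0; rewrite scale0r addr0 => <-.
suff -> : evalp_curve q g = 0 by rewrite horner0.
by apply: (poly_eq0_off_roots D0) => s Ds; rewrite gE E.
Qed.

(* This plays the role of the irreducibility of [X]. *)
Lemma evalp_quotient0 (p : mpoly n K) :
  (forall z, evalp p (fG (chart z)) = 0) -> forall x, X x -> evalp p x = 0.
Proof.
move=> pz.
have pG G : isotropic G -> plane G != 0 -> evalp p (fG G) = 0.
  move: G; apply: isotropic_connected => [G G' D G0 Gn G'0 D0|G G0 [m12 _]].
    exact: evalp_line_closed.
  have [z Ez] := chart_surj G0 m12.
  by rewrite (fG_inj G0 (isotropic_chart z) Ez).
move=> x /(quotient_fG)[G G0 ->].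
have [G00|] := eqVneq (plane G) 0; last exact: pG.
rewrite (fG_inj G0 isotropic0) ?plane0 //.
(* The vertex is the point [s = 0] of the line [s *: Gbase], whose other points have nonzero
   bivector. *)
apply: (@evalp_line_closed p 0 (Gbase K) 'X); first by rewrite polyX_eq0.
move=> s; rewrite hornerX add0r => s0.
have -> : s *: Gbase K = Gbase K *m s%:M by rewrite mul_mx_scalar.
apply: pG; first exact/isotropic_col/isotropic_Gbase.
by rewrite plane_col det_scalar scaler_eq0 expf_eq0 /= negb_or s0 plane_Gbase.
Qed.

(** Pulled back along the chart, the functions become polynomials in ten variables; by
    [evalp_quotient0] a relation among the pullbacks holds on all of [X]. *)
Lemma has_alg_indep_quotient_le d : has_alg_indep X d -> (d <= 10)%N.
Proof.
move=> [h hP]; rewrite leqNgt; apply/negP => d10.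
pose psi i := comp_map (f i) (chart_cvec K).
have psiE z : evalmap psi z = fG (chart z).
  by apply/rowP => i; rewrite !mxE evalp_comp evalmap_chart_cvec.
have [P P0 Pz] := alg_dependent (fun i => comp_map (h i) psi) d10.
case/eqP: P0; apply: hP => x Xx; rewrite -evalp_comp.
apply: evalp_quotient0 Xx => z; rewrite evalp_comp.
have := congr1 (fun p => evalp p z) Pz; rewrite evalp_comp evalp0 => <-.
by congr evalp; apply/rowP => i; rewrite !mxE evalp_comp psiE.
Qed.

(** The coordinates [kap] take every value with nonzero first entry on the cone, so a relation times
    the first variable vanishes everywhere. *)
Lemma has_alg_indep_quotient : has_alg_indep X 10.
Proof.
(* Right multiplication by [J8] in [kap] reverses the columns, whence the reversed second index. *)
pose h (k : 'I_10) : mpoly n K := - phi (mxvec_index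
  (inord (kap_idx k).1) (rev_ord (inord (kap_idx k).2))).
have hE G : isotropic G -> evalmap h (fG G) = kap (plane G).
  move=> G0; apply/rowP => k; rewrite !mxE evalpN.
  have -> i : evalp (phi i) (fG G) = evalmap phi (fG G) ord0 i by rewrite mxE.
  rewrite (phi_fG G0) mxvecE; congr (- _).
  rewrite (bigD1 (rev_ord (inord (kap_idx k).2))) //= big1 => [|l lk].
    rewrite !mxE addr0 (_ : (_ + _ == 7)%N) ?mulr1 //=.
    by case: (inord _) => ? ? /=; lia.
  rewrite !mxE; case: eqP => [E|]; last by rewrite mulr0.
  by case/eqP: lk; apply: val_inj => /=; case: l (inord _) E => ? ? [? ?] /=; lia.
exists h => P PX; pose z0 : mpoly 10 K := mpolyX K (mnm1 ord0).
have : z0 * P = 0.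
  apply: mpoly_eq0_evalp => w; rewrite evalpM evalpX.
  have [->|w0] := eqVneq (w ord0 ord0) 0; first by rewrite mul0r.
  (* This solves [kap (plane (chart z)) = w] by means of [kap_chart]. *)
  pose z : 'rV[K]_10 := \row_k if k == ord0 then w ord0 ord0
    else w ord0 k / w ord0 ord0.
  have := PX _ (fG_quotient (isotropic_chart z)).
  rewrite hE; last exact: isotropic_chart.
  suff -> : kap (plane (chart z)) = w by move=> ->; rewrite mulr0.
  apply/rowP => k; rewrite kap_chart !mxE eqxx.
  by case: eqP => [->|_]; rewrite ?mulr1 // mulrC divfK.
move=> /eqP; rewrite mulf_eq0 => /orP[/eqP z00|/eqP //].
have := congr1 (fun p => evalp p (const_mx 1)) z00.
by rewrite evalpX mxE evalp0 => /eqP; rewrite oner_eq0.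
Qed.

Lemma vdim_quotient : vdim X = 10.
Proof.
(* [vdim] only considers [d <= n], so the bound on the ambient dimension comes first. *)
have n10 : (10 < n.+1)%N.
  rewrite ltnS leqNgt; apply/negP => n10; have [h hP] := has_alg_indep_quotient.
  have [P P0 Pz] := alg_dependent h n10.
  by case/eqP: P0; apply: hP => x _; rewrite -evalp_comp Pz evalp0.
apply/eqP; rewrite eqn_leq; apply/andP; split.
  by apply/bigmax_leqP => d /asboolP; apply: has_alg_indep_quotient_le.
apply: (@leq_bigmax_cond _ _ (fun d : 'I_n.+1 => d : nat) (Ordinal n10)).
exact/asboolP/has_alg_indep_quotient.
Qed.

Lemma isotangent_linear (G U V : 'M[K]_(8, 2)) a :
  isotangent G U -> isotangent G V -> isotangent G (a *: U + V).
Proof.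
rewrite /isotangent => EU EV.
have -> : (a *: U + V)^T = a *: U^T + V^T by rewrite linearD linearZ.
rewrite mulmxDr !mulmxDl -!(scalemxAl, scalemxAr) addrACA EV addr0.
by rewrite -scalerDr EU scaler0.
Qed.

(** By homogeneity [G] may be replaced by [g *m Gbase]. There [lam] parametrises the tangent space,
    injectively by [kap_lam] and surjectively by [kap_inj], which gives the ten rows of [B]. *)
Lemma smooth_fG G : isotropic G -> plane G != 0 -> smooth_locus X (fG G).
Proof.
move=> G0 Gn; split; first exact: fG_quotient.
rewrite (vdim_quotient).
have GbO : Omin (plane G) by apply/(Omin_plane); exists G.
have b0 := isotropic_Gbase K; have bn := plane_Gbase K.
have [g Sg Eg] := orbit_plane b0 bn GbO.
have gb0 : isotropic (g *m Gbase K) by exact: isotropic_orbit.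
have gbn : plane (g *m Gbase K) != 0 by rewrite -Eg.
have gu := SO8_unit Sg.
rewrite (fG_inj G0 gb0 Eg).
have Tg U : isotangent (Gbase K) U ->
    tangent X (fG (g *m Gbase K)) (dfG (g *m Gbase K) (g *m U)) /\
    diffmap phi (fG (g *m Gbase K)) (dfG (g *m Gbase K) (g *m U)) =
      mxvec (g *m dplane (Gbase K) U *m invmx g).
  move=> TU; have TgU : isotangent (g *m Gbase K) (g *m U) by apply/isotangent_orbit.
  have [? ->] := dfG_tangent gb0 gbn TgU; split=> //.
  by rewrite dplane_orbit.
pose B := \matrix_i dfG (g *m Gbase K) (g *m lam (delta_mx ord0 i : 'rV[K]_10)).
have BE v : v *m B = dfG (g *m Gbase K) (g *m lam v).
  have dl a u w : dfG (g *m Gbase K) (g *m lam (a *: u + w)) =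
      a *: dfG (g *m Gbase K) (g *m lam u) + dfG (g *m Gbase K) (g *m lam w).
    by rewrite lam_linear mulmxDr -scalemxAr dfG_linear.
  apply/rowP => k; rewrite (@linear_form_sum _ _ (fun v => dfG (g *m Gbase K) (g *m lam v) ord0 k)).
    by rewrite mxE; apply: eq_bigr => i _; rewrite [B i k]mxE.
  by move=> a u w; rewrite dl; move: (dfG _ _) (dfG _ _) => p q; rewrite !mxE.
exists B; split.
  apply: inj_row_free => v; rewrite BE => vB; have [_] := Tg _ (isotangent_lam v).
  rewrite vB diffmapE mul0mx => /esym/eqP.
  rewrite mxvec_eq0 => /eqP E; rewrite -[v]kap_lam.
  have -> : dplane (Gbase K) (lam v) = 0.
    by rewrite -[dplane _ _](mulKmx gu) -[g *m _](mulmxKV gu) E mul0mx mulmx0.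
  by apply/rowP => k; rewrite [LHS]mxE mul0mx !mxE oppr0.
move=> u; split=> [/(tangent_fG _ gb0 gbn)[V TV ->]|].
  pose U := invmx g *m V; have VU : V = g *m U by rewrite mulKVmx.
  have TU : isotangent (Gbase K) U by apply/(@isotangent_orbit _ g) => //; rewrite -VU.
  apply/submxP; exists (kap (dplane (Gbase K) U)); set v := kap _.
  have [T1 d1] := Tg _ TU; have [T2 d2] := Tg _ (isotangent_lam v).
  rewrite BE VU; apply: (diffmap_phi_inj (fG_quotient gb0) T1 T2).
  suff E : dplane (Gbase K) U = dplane (Gbase K) (lam v) by rewrite d1 d2 E.
  apply/eqP; rewrite -subr_eq0.
  have -> : dplane (Gbase K) U - dplane (Gbase K) (lam v) =
      dplane (Gbase K) (-1 *: lam v + U).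
    by rewrite dplane_linear scaleN1r addrC.
  apply/eqP/kap_inj; last by rewrite dplane_linear kap_linear kap_lam scaleN1r addNr.
  exact/isotangent_linear/TU/isotangent_lam.
by move=> /submxP[v ->]; rewrite BE; have [] := Tg _ (isotangent_lam v).
Qed.

(* The tangent space at the vertex of the cone contains the cone itself, hence
   more than ten independent vectors. *)
Lemma not_smooth_vertex : ~ smooth_locus X (fG 0).
Proof.
move=> [X0 [B [_ TB]]]; move: B TB; rewrite (vdim_quotient).
move=> B TB; case: phi_iso => g [_ YX gphi phig].
have Ycone G : isotropic G -> Y (mxvec (plane G)).
  move=> G0; exists (plane G) => //.
  by have [|->] := plane_closure G0; [left|right].
have Y0 : Y 0 by have := Ycone _ isotropic0; rewrite plane0 linear0.
have g0 : evalmap g 0 = fG 0.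
  rewrite -(gphi _ (fG_quotient isotropic0)) (phi_fG isotropic0).
  by rewrite plane0 linear0.
have TY G : isotropic G -> tangent Y 0 (mxvec (plane G)).
  move=> G0 p pv; rewrite (@diffp_line _ _ _ _ _ 0) ?coef0 // => s.
  rewrite add0r horner0; apply: pv.
  (* Rescaling only one column multiplies the bivector by [s] itself rather than by its square. *)
  pose a : 'M[K]_2 := \matrix_(i, j) if i == j then if i == ord0 then s else 1 else 0.
  have -> : s *: mxvec (plane G) = mxvec (plane (G *m a)).
    by rewrite plane_col det22 !mxE /= linearZ; congr (_ *: _); ring.
  exact/Ycone/isotropic_col.
(* Eleven coordinate planes, one more than the dimension; no two indices in a pair are opposite, so
   all are isotropic. *)
pose idx (k : nat) : nat * nat := nth (0, 0)%N [:: (0, 1); (0, 2); (0, 3); (0, 4);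
  (0, 5); (0, 6); (1, 2); (1, 3); (1, 4); (1, 5); (1, 7)]%N k.
pose G (k : 'I_11) := colpair (delta_mx (inord (idx k).1) ord0 : 'cV[K]_8)
  (delta_mx (inord (idx k).2) ord0).
have G0 k : isotropic (G k).
  apply/isotropic_colpair; rewrite !form8_delta.
  by case: k => -[|[|[|[|[|[|[|[|[|[|[|]]]]]]]]]]] // ?; rewrite /= !inordK.
pose M := \matrix_(k < 11) mxvec (plane (G k)).
have Mfree : row_free M.
  apply: inj_row_free => v vM; apply/rowP => k; rewrite [RHS]mxE.
  pose l (N : 'M[K]_8) := (N *m J8 K) (inord (idx k).2) (inord (idx k).1).
  have lG k' : l (plane (G k')) = (k == k')%:R.
    rewrite /l plane_colpair wedge8_delta -mulmxA JJ mulmx1 !mxE.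
    case: k k' {l} => k k11 [k' k'11]; rewrite -!val_eqE /=.
    case: k k11 => [|[|[|[|[|[|[|[|[|[|[|]]]]]]]]]]] // _;
    case: k' k'11 => [|[|[|[|[|[|[|[|[|[|[|]]]]]]]]]]] // _;
    by rewrite /= !inordK //= ?subr0.
  have := congr1 (fun w => l (vec_mx w)) vM.
  have -> : vec_mx (v *m M) = \sum_k' v ord0 k' *: plane (G k').
    rewrite mulmx_sum_row linear_sum; apply: eq_bigr => k' _.
    by rewrite linearZ rowK /= mxvecK.
  have lL a N N' : l (a *: N + N') = a * l N + l N'.
    by rewrite /l mulmxDl -scalemxAl !mxE.
  have l0 : l 0 = 0 by rewrite /l mul0mx mxE.
  rewrite linear0 l0 => <-.
  have -> : l (\sum_k' v ord0 k' *: plane (G k')) = \sum_k' v ord0 k' * l (plane (G k')).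
    by elim/big_rec2: _ => // k' y z _ <-; rewrite lL.
  rewrite (bigD1 k) //= lG eqxx mulr1 big1 ?addr0 // => k' kk'.
  by rewrite lG eq_sym (negPf kk') mulr0.
(* The differential of [phi] recovers [M] from [W], so [W] has rank 11 inside the row space of [B],
   which has ten rows. *)
pose W := M *m jacobian_mx g 0.
have WM : W *m jacobian_mx phi (fG 0) = M.
  apply/row_matrixP => k; rewrite row_mul row_mul rowK -!diffmapE -g0.
  exact: (diffmap_inverse phig (TY _ (G0 k))).
have WB : (W <= B)%MS.
  apply/row_subP => k; apply/TB; rewrite row_mul rowK -diffmapE -g0.
  by apply: (tangent_map YX); exact/TY/G0.
have := leq_trans (mxrankM_maxl W (jacobian_mx phi (fG 0))) (mxrankS WB).
rewrite WM (eqnP Mfree) => /leq_trans/(_ (rank_leq_row B)).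
by rewrite ltnn.
Qed.

Lemma smooth_quotientP x : smooth_locus X x <->
  exists G, [/\ isotropic G, plane G != 0 & x = fG G].
Proof.
split=> [Sx|[G [G0 Gn ->]]]; last exact: smooth_fG.
have [G G0 xE] := quotient_fG (proj1 Sx).
exists G; split=> //; apply/eqP => Gz; apply: not_smooth_vertex.
by rewrite -(fG_inj G0 isotropic0) -?xE // plane0.
Qed.

End Quotient.

(** * Comparison of the symplectic forms *)

Section Limits.
Variable C : numFieldType.

Lemma poly_neq0_near (D : {poly C}) : D != 0 ->
  forall S : set C, nbhs 0 S -> exists2 s, S s & D.[s] != 0.
Proof.
move=> D0 S /nbhs_ballP[e /= e0 eS]; apply: contrapT => noS.
case/eqP: D0; pose t k : C := e / k.+2%:R.
have t_inj : injective t.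
  by move=> i j /(mulfI (lt0r_neq0 e0))/invr_inj/eqP; rewrite eqr_nat => /eqP [].
apply: (@roots_geq_poly_eq0 _ D [seq t i | i <- iota 0 (size D)]).
- apply/allP => s /mapP[k _ ->]; rewrite rootE; apply/negPn/negP => Dk; apply: noS.
  exists (t k) => //; apply: eS; rewrite /ball /= sub0r normrN ger0_norm /t.
    by rewrite ltr_pdivrMr // ltr_pMr // ltr1n.
  by rewrite divr_ge0 // ltW.
- by rewrite map_inj_uniq ?iota_uniq.
- by rewrite size_map size_iota.
Qed.

Lemma cvg_horner (p : {poly C}) (a : C) : (fun s : C => p.[s]) @ a --> p.[a].
Proof.
have FF : Filter (nbhs a) by exact: nbhs_filter.
elim/poly_ind: p => [|p c IH].
  under eq_fun do rewrite horner0; rewrite horner0; exact: cvg_cst.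
under eq_fun do rewrite !hornerE; rewrite !hornerE.
by apply: cvgD; [apply: cvgM => //; exact: cvg_id|exact: cvg_cst].
Qed.

Lemma cvg_horner_mx m (p : 'I_m -> {poly C}) (a : C) :
  (fun s => \row_i (p i).[s] : 'rV[C]_m) @ a --> (\row_i (p i).[a] : 'rV[C]_m).
Proof.
have FF : Filter (nbhs a) by exact: nbhs_filter.
apply/cvg_ballP => e e0.
have H : \forall s \near nbhs a, forall j, ball (p j).[a] e (p j).[s].
  apply: (@filter_forall C _ (fun j s => ball (p j).[a] e (p j).[s]) _ (nbhs_filter a)) => j.
  by have /cvg_ballP/(_ e e0) := @cvg_horner (p j) a.
by apply: filterS H => s H; split=> // i j; rewrite !mxE.
Qed.

Lemma cvg_sum_ord n (F : 'I_n -> C -> C) (l : 'I_n -> C) (a : C) :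
  (forall i, (fun s => F i s) @ a --> l i) ->
  (fun s => \sum_i F i s) @ a --> \sum_i l i.
Proof.
have FF : Filter (nbhs a) by exact: nbhs_filter.
by move=> Fl; apply: cvg_big => [|i _]; [exact: add_continuous|exact: Fl].
Qed.

Definition row_horner n (p : 'I_n -> {poly C}) (s : C) : 'rV[C]_n :=
  \row_i (p i).[s].

(** [h] is continuous at 0, and points with [h s = c] accumulate there since [D] has finitely many
    roots. *)
Lemma form_limit n (A : 'rV[C]_n -> 'M[C]_n) (p u v : 'I_n -> {poly C})
    (D : {poly C}) (W : set 'rV[C]_n) (c : C)
    (h := fun s => (row_horner u s *m A (row_horner p s) *m (row_horner v s)^T) ord0 ord0) :
  D != 0 -> {for row_horner p 0, continuous A} -> nbhs (row_horner p 0) W ->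
  (forall s, D.[s] != 0 -> W (row_horner p s) -> h s = c) -> h 0 = c.
Proof.
move=> D0 Ac Wp hc; have FF : Filter (nbhs (0 : C)) by exact: nbhs_filter.
have pc : (fun s => row_horner p s) @ (0 : C) --> row_horner p 0.
  exact: cvg_horner_mx.
have hE s : h s = \sum_j (\sum_i (u i).[s] * A (row_horner p s) i j) * (v j).[s].
  rewrite /h mxE; apply: eq_bigr => j _; rewrite !mxE; congr (_ * _).
  by apply: eq_bigr => i _; rewrite mxE.
have hcvg : h @ (0 : C) --> h 0.
  rewrite (_ : h = fun s => h s) //; under eq_fun do rewrite hE; rewrite hE.
  apply: cvg_sum_ord => j; apply: cvgM; last exact: cvg_horner.
  apply: cvg_sum_ord => i; apply: cvgM; first exact: cvg_horner.
  apply: (@cvg_comp _ _ _ (fun s => A (row_horner p s)) (fun M => M i j)).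
    exact: (continuous_cvg _ Ac pc).
  exact: coord_continuous.
apply/eqP/negPn/negP => h0c.
have e0 : 0 < `|h 0 - c| by rewrite normr_gt0 subr_eq0.
have N1 : \forall s \near nbhs (0 : C), `|h 0 - h s| < `|h 0 - c|.
  exact: (cvgr_dist_lt _ _ hcvg).
have N2 : \forall s \near nbhs (0 : C), W (row_horner p s) by exact: pc.
have [s [s1 s2] Ds] := poly_neq0_near D0 (filterI N1 N2).
by move: s1; rewrite (hc _ Ds s2) ltxx.
Qed.

End Limits.

(** * The Kirillov-Kostant-Souriau form on bivectors, and polynomial curves in the quotient *)

Section KKSForm.
Variable K : numFieldType.

(** Invariance of the trace form: the value depends on [A] and [B] only through their brackets with
    [M], so the form [KKS] is well defined. *)
Lemma kappa_lie (M A B : 'M[K]_8) : (kappa M (lie A B) = - \tr (lie A M *m B)) *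
  (kappa M (lie A B) = \tr (lie B M *m A)).
Proof.
have trB (P Q : 'M[K]_8) : \tr (P - Q) = \tr P - \tr Q by exact: raddfB.
split; rewrite /kappa /lie !mulmxBl !mulmxBr !trB ?opprB !mulmxA.
  by congr (_ - _); rewrite mxtrace_mulC mulmxA.
by congr (_ - _); rewrite mxtrace_mulC mulmxA.
Qed.

Lemma KKS_plane (G U V : 'M[K]_(8, 2)) :
  plane G != 0 -> isotangent G U -> isotangent G V ->
  KKS (plane G) (dplane G U) (dplane G V) =
    \tr (eps K *m U^T *m J8 K *m V) *+ 2.
Proof.
move=> Gn TU TV; have [H HG] := left_inverse_plane Gn.
have [A A0 AU] := isotangent_witt HG TU; have [B B0 BV] := isotangent_witt HG TV.
rewrite -{1}AU -{1}BV !dplane_so8 // -AU -BV -kappa_plane_lie // /KKS.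
set S := [set r | _].
(* The lifts [A], [B] show that the set is inhabited, so [xget] returns the value for some lifts
   [A'], [B'] and not the default 0. *)
have : S (xget 0 S).
  by apply: (@xgetPex K 0 S); exists (kappa (plane G) (lie A B)); exists A, B.
move=> [A' [B' [_ _ EA EB ->]]].
rewrite (kappa_lie _ A' B').1 -EA -(kappa_lie _ A B').1.
by rewrite (kappa_lie _ A B').2 -EB -(kappa_lie _ A B).2.
Qed.

Lemma plane_transvection_neq0 (G' G : 'M[K]_(8, 2)) s : isotropic G' ->
  plane G != 0 -> plane (G + s *: (plane G' *m G)) != 0.
Proof.
move=> G'0 Gn; have [H HG] := left_inverse_plane Gn.
apply: (@plane_neq0 _ _ (H *m (1%:M - s *: plane G'))).
rewrite -mulmxA; have -> : (1%:M - s *: plane G') *m (G + s *: (plane G' *m G)) = G.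
  rewrite mulmxBl mul1mx mulmxDr -!(scalemxAl, scalemxAr) mulmxA plane_sq //.
  by rewrite mul0mx !scaler0 addr0 addrK.
by rewrite HG.
Qed.

Variables (n : nat) (f : 'I_n -> mpoly dimTV K).

Lemma fG_curve (G E : 'M[K]_(8, 2)) :
  exists p, row_horner p 0 = fG f G /\
    forall s, row_horner p s = fG f (G + s *: E).
Proof.
pose g i : {poly K} := (cvec G ord0 i)%:P + cvec E ord0 i *: 'X.
suff E1 s : row_horner (fun i => evalp_curve (f i) g) s = fG f (G + s *: E).
  by exists (fun i => evalp_curve (f i) g); split=> //; rewrite E1 scale0r addr0.
apply/rowP => i.
rewrite !mxE evalp_curve_horner /fG -cvec_line; congr evalp.
by move: (cvec G) (cvec E) @g => a b; apply/rowP => k; rewrite !mxE !hornerE [s * _]mulrC.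
Qed.

Lemma dfG_curve (G E U E' : 'M[K]_(8, 2)) :
  exists p, row_horner p 0 = dfG f G U /\
    forall s, row_horner p s = dfG f (G + s *: E) (U + s *: E').
Proof.
pose g (G E : 'M[K]_(8, 2)) i : {poly K} := (cvec G ord0 i)%:P + cvec E ord0 i *: 'X.
have gE G' E1 s k : (g G' E1 k).[s] = cvec (G' + s *: E1) ord0 k.
  rewrite -cvec_line /g; move: (cvec _) (cvec _) => a b.
  by rewrite !mxE !hornerE [s * _]mulrC.
pose p i := \sum_k evalp_curve (mderiv k (f i)) (g G E) * g U E' k.
suff E1 s : row_horner p s = dfG f (G + s *: E) (U + s *: E').
  by exists p; split=> //; rewrite E1 !scale0r !addr0.
apply/rowP => i; rewrite !mxE horner_sum; apply: eq_bigr => k _.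
rewrite hornerM gE evalp_curve_horner; congr (evalp _ _ * _).
by apply/rowP => l; rewrite mxE gE.
Qed.

End KKSForm.

(** * The symplectic form in terms of isotropic pairs *)

Section SymplecticForm.
Variables (R : realType) (n : nat) (f : 'I_n -> mpoly dimTV (Cplx R)).
Variables (Omin : set 'M[Cplx R]_8) (phi : 'I_(8 * 8) -> mpoly n (Cplx R)).
Variable omega : form2 R n.
Local Notation C := (Cplx R).
Local Notation X := (quotientN f).
Local Notation Y := (mxvec @` (Omin `|` [set 0]) : set 'rV[C]_(8 * 8)).
Hypothesis Omin_orbit : exists2 M, M != 0 & Omin = orbit8 M.
Hypothesis phi_iso : is_isomorphism X Y phi.
Hypothesis phi_Psi : forall q, N q ->
  evalmap phi (evalmap f (coords q)) = mxvec (Psi q).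
Hypothesis omegaP : is_symplectic_form f omega.

(* [omegaV] is preserved by the group elements [1 + s A], so that the equality
   of the two forms propagates along their orbits, by continuity at [s = 0]. *)
Lemma omega_isotangent (G : 'M[C]_(8, 2)) : isotropic G -> plane G != 0 ->
  forall U V, isotangent G U -> isotangent G V ->
  omega (fG f G) (dfG f G U) (dfG f G V) = \tr (eps C *m U^T *m J8 C *m V).
Proof.
case: omegaP => om_hol om_inj.
move: G; apply: isotropic_connected => [G G' D G0 Gn G'0 D0 HG|G G0 Gg] U V TU TV.
  set c := \tr _.
  have [_ [A nearA]] := om_hol _ (smooth_fG Omin_orbit phi_iso phi_Psi G0 Gn).
  have [p [p0 pE]] := fG_curve f G (plane G' *m G).
  have [u [u0 uE]] := dfG_curve f G (plane G' *m G) U (plane G' *m U).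
  have [v [v0 vE]] := dfG_curve f G (plane G' *m G) V (plane G' *m V).
  rewrite -p0 in nearA; have [diffA omA] := nbhs_singleton nearA.
  have Sp : smooth_locus X (row_horner p 0).
    rewrite p0; exact: (smooth_fG Omin_orbit phi_iso phi_Psi).
  have Tu : tangent X (row_horner p 0) (row_horner u 0).
    rewrite p0 u0; exact: (dfG_tangent phi_Psi G0 Gn TU).1.
  have Tv : tangent X (row_horner p 0) (row_horner v 0).
    rewrite p0 v0; exact: (dfG_tangent phi_Psi G0 Gn TV).1.
  rewrite -u0 -v0 -p0 (omA Sp _ _ Tu Tv).
  apply: (form_limit D0 (differentiable_continuous diffA) nearA) => s Ds [_ omE].
  have Gs0 := isotropic_transvection s G'0 G0.
  have Gsn := plane_transvection_neq0 s G'0 Gn.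
  have TUs := isotangent_transvection s G'0 TU.
  have TVs := isotangent_transvection s G'0 TV.
  rewrite -omE pE ?uE ?vE; first last.
  - exact: (dfG_tangent phi_Psi Gs0 Gsn TVs).1.
  - exact: (dfG_tangent phi_Psi Gs0 Gsn TUs).1.
  - exact: (smooth_fG Omin_orbit phi_iso phi_Psi).
  rewrite (HG s Ds _ _ TUs TVs).
  (* The transvection preserves the bilinear form, so the pairing does not depend on [s]. *)
  by rewrite -!mulmxA [_^T *m _]mulmxA transvection_form // /c !mulmxA.
(* For good [G] the quiver point lies in [Ninj], where Hamiltonian reduction prescribes [omega]. *)
have TN W : isotangent G W -> tangentN (Finv G) (Finv W).
  by move=> TW; apply/tangentNP; rewrite !Fmat_Finv.
have := om_inj _ (Ninj_good G0 Gg) _ _ (TN _ TU) (TN _ TV).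
by rewrite omegaV_form !Fmat_Finv => <-.
Qed.

End SymplecticForm.

Theorem theorem6p1 (R : realType) (n : nat)
    (f : 'I_n -> mpoly dimTV (Cplx R))
    (Omin : set 'M[Cplx R]_8)
    (phi : 'I_(8 * 8) -> mpoly n (Cplx R))
    (omega : form2 R n)
    (hf : generates_invariants f)
    (hO : is_minimal_nilpotent_orbit Omin)
    (hphi : is_isomorphism (quotientN f) (mxvec @` (Omin `|` [set 0])) phi)
    (hphiF : forall q, N q ->
       evalmap phi (evalmap f (coords q)) = mxvec (Psi q))
    (homega : is_symplectic_form f omega) :
  evalmap phi @` smooth_locus (quotientN f) = mxvec @` Omin /\
  exists c : Cplx R, c != 0 /\
    forall x u v, smooth_locus (quotientN f) x ->
      tangent (quotientN f) x u -> tangent (quotientN f) x v ->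
      omega x u v = c * KKS (vec_mx (evalmap phi x))
                            (vec_mx (diffmap phi x u))
                            (vec_mx (diffmap phi x v)).
Proof.
have Omin_orbit : exists2 M, M != 0 & Omin = orbit8 M.
  by case: hO => M [[_ M0 _] OE] _; exists M.
have smP := smooth_quotientP Omin_orbit hphi hphiF.
split.
  apply/seteqP; split=> [_ [x /smP[G [G0 Gn ->]] <-]|_ [M OM <-]].
    exists (plane G); last by rewrite (phi_fG hphiF G0).
    by apply/(Omin_plane Omin_orbit hphi hphiF); exists G.
  have /(Omin_plane Omin_orbit hphi hphiF)[G [G0 Gn ->]] := OM.
  by exists (fG f G); [apply/smP; exists G|rewrite (phi_fG hphiF G0)].
(* By [KKS_plane] the Kirillov-Kostant-Souriau form is twice the pairing that [omega_isotangent]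
   gives for [omega]. *)
exists 2^-1; split; first by rewrite invr_neq0 // pnatr_eq0.
move=> x u v /smP[G [G0 Gn ->]].
move=> /(tangent_fG Omin_orbit hphi hphiF _ G0 Gn)[U TU ->].
move=> /(tangent_fG Omin_orbit hphi hphiF _ G0 Gn)[V TV ->].
rewrite (omega_isotangent Omin_orbit hphi hphiF homega G0 Gn TU TV).
have vec3 (M A B : 'M[Cplx R]_8) m a b : m = mxvec M -> a = mxvec A -> b = mxvec B ->
    KKS (vec_mx m) (vec_mx a) (vec_mx b) = KKS M A B.
  by move=> -> -> ->; rewrite !mxvecK.
rewrite (vec3 _ _ _ _ _ _ (phi_fG hphiF G0) (dfG_tangent hphiF G0 Gn TU).2
  (dfG_tangent hphiF G0 Gn TV).2).
by rewrite (KKS_plane Gn TU TV) -[X in _ * X]mulr_natl mulrA mulVf ?mul1r // pnatr_eq0.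
Qed.
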